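(* Let $M$ be a surface isometrically immersed in $\mathbb{E}^3$ whose angle function $\theta$ takes values in $(0,\pi)\setminus\{\frac{\pi}{2}\}$ and is not constant. Then $M$ is a minimal surface with $U$ a principal direction if and only if the immersion is, locally in suitable coordinates $(x,y)$ and up to isometries of the ambient space, given by $$r(x,y)=\left(\sqrt{x^2+c^2}\,\cos y,\ \sqrt{x^2+c^2}\,\sin y,\ c\ln\big(x+\sqrt{x^2+c^2}\big)\right),\qquad c\in\mathbb{R},\ c\neq 0.$$
   Context: $\mathbb{E}^3$ is Euclidean 3-space with scalar product $\langle\cdot,\cdot\rangle$ and a fixed unit vector (fixed direction) $\overrightarrow{k}$. $M$ is a smooth connected surface isometrically immersed in $\mathbb{E}^3$ with unit normal $N$ and shape operator $A$ given by $\widetilde\nabla_X N=-AX$, where $\widetilde\nabla$ is the flat connection. The angle function is $\theta(p)=\angle(N(p),\overrightarrow{k})\in(0,\pi)$, and $U$ is the tangent part of $\overrightarrow{k}$: $\overrightarrow{k}=U+\cos\theta\,N$. ''$U$ is a principal direction'' means that $AU$ is everywhere a multiple of $U$. ''Minimal'' means $\mathrm{trace}\,A=0$. The statement is local (in a neighborhood of any point). The isometries in question are those carrying $\overrightarrow{k}$ to the third coordinate vector $(0,0,1)$; in the parametrization the third coordinate is along $\overrightarrow{k}$. *)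

(* Defs.v *)
From HB Require Import structures.
From mathcomp Require Import all_boot all_order all_algebra.
From mathcomp Require Import all_classical all_reals all_analysis.
From mathcomp Require Import lra.
Set Implicit Arguments.
Unset Strict Implicit.
Unset Printing Implicit Defensive.
Import Order.TTheory GRing.Theory Num.Theory.
Import numFieldNormedType.Exports.
Local Open Scope classical_set_scope.
Local Open Scope ring_scope.

Notation plane R := 'rV[R]_2 (only parsing).
Notation space R := 'rV[R]_3 (only parsing).

(* The library norm on row vectors is the sup norm, hence the Euclidean
   scalar product and norm below. *)
Definition dot (R : realType) n (u v : 'rV[R]_n) : R := (u *m v^T) 0 0.

Definition enorm (R : realType) n (u : 'rV[R]_n) : R := Num.sqrt (dot u u).

Definition angle (R : realType) n (u v : 'rV[R]_n) : R :=
  acos (dot u v / (enorm u * enorm v)).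

(* Only meaningful for an open domain [D]. *)
Fixpoint C_on (R : realType) (V W : normedModType R) (n : nat) (D : set V)
    (f : V -> W) : Prop :=
  match n with
  | 0 => forall x, D x -> {for x, continuous f}
  | n'.+1 => (forall x, D x -> differentiable f x) /\
             forall v : V, C_on n' D (fun x => 'D_v f x)
  end.

Definition smooth_on (R : realType) (V W : normedModType R) (D : set V)
    (f : V -> W) : Prop := forall n, C_on n D f.

(* [chart_map] matters only on [chart_dom], and [chart_inv] only on the image
   [chart_cod] of [chart_dom]. *)
Record chart (R : realType) (M : topologicalType) := Chart {
  chart_dom : set M;
  chart_map : M -> plane R;
  chart_inv : plane R -> M }.

Definition chart_cod (R : realType) (M : topologicalType) (e : chart R M) :
  set (plane R) := chart_map e @` chart_dom e.

Definition is_chart (R : realType) (M : topologicalType) (e : chart R M) :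
    Prop :=
  [/\ open (chart_dom e), open (chart_cod e),
      forall p, chart_dom e p -> chart_inv e (chart_map e p) = p,
      forall p, chart_dom e p -> {for p, continuous (chart_map e)} &
      forall x, chart_cod e x -> {for x, continuous (chart_inv e)}].

Definition overlap (R : realType) (M : topologicalType) (e1 e2 : chart R M) :
  set (plane R) := chart_map e1 @` (chart_dom e1 `&` chart_dom e2).

Definition transition (R : realType) (M : topologicalType)
    (e1 e2 : chart R M) : plane R -> plane R :=
  fun x => chart_map e2 (chart_inv e1 x).

Definition compatible (R : realType) (M : topologicalType)
    (e1 e2 : chart R M) : Prop :=
  smooth_on (overlap e1 e2) (transition e1 e2) /\
  smooth_on (overlap e2 e1) (transition e2 e1).

(* Connected smooth Riemannian surface.  A tangent vector at [p] is given by
   its coordinates [v : plane R] in a chart around [p]; [metric e x] is the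
   Gram matrix of the coordinate frame of [e] at the point of coordinates [x].
   Linear maps act on row vectors on the right, so that the Jacobian [J] of a
   map sends [v] to [v *m J]. *)
Record surface (R : realType) := Surface {
  carrier :> topologicalType;
  atlas : set (chart R carrier);
  metric : chart R carrier -> plane R -> 'M[R]_2;
  surface_hausdorff : hausdorff_space carrier;
  surface_second_countable : @second_countable carrier;
  surface_connected : connected [set: carrier];
  atlas_chart : forall e, atlas e -> is_chart e;
  atlas_cover : forall p, exists2 e, atlas e & chart_dom e p;
  atlas_compatible : forall e1 e2, atlas e1 -> atlas e2 -> compatible e1 e2;
  metric_smooth : forall e, atlas e -> forall i j,
    smooth_on (chart_cod e) (fun x => metric e x i j : R^o);
  metric_sym : forall e x, atlas e -> chart_cod e x ->
    (metric e x)^T = metric e x;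
  metric_pos : forall e x, atlas e -> chart_cod e x ->
    forall v : plane R, v != 0 -> 0 < (v *m metric e x *m v^T) 0 0;
  metric_transition : forall e1 e2 x, atlas e1 -> atlas e2 ->
    overlap e1 e2 x ->
    let J := jacobian (transition e1 e2) x in
    metric e1 x = J *m metric e2 (transition e1 e2 x) *m J^T }.

Definition coordinate_chart (R : realType) (M : surface R) (e : chart R M) :
    Prop :=
  is_chart e /\ forall e', atlas e' -> compatible e e'.

Definition local_expr (R : realType) (M : topologicalType) (e : chart R M)
    (f : M -> space R) : plane R -> space R :=
  fun x => f (chart_inv e x).

(* Matrix, in the chart [e], of the differential of [f] at the point of
   coordinates [x]. *)
Definition dmap (R : realType) (M : topologicalType) (e : chart R M)
    (f : M -> space R) (x : plane R) : 'M[R]_(2, 3) :=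
  jacobian (local_expr e f) x.

Definition smooth_map (R : realType) (M : surface R) (f : M -> space R) :
    Prop :=
  forall e, atlas e -> smooth_on (chart_cod e) (local_expr e f).

Definition isometric_immersion (R : realType) (M : surface R)
    (F : M -> space R) : Prop :=
  smooth_map F /\
  forall e x, atlas e -> chart_cod e x ->
    row_free (dmap e F x) /\ dmap e F x *m (dmap e F x)^T = metric e x.

Definition unit_normal (R : realType) (M : surface R) (F N : M -> space R) :
    Prop :=
  [/\ smooth_map N,
      forall p, dot (N p) (N p) = 1 &
      forall e x, atlas e -> chart_cod e x ->
        forall v : plane R, dot (v *m dmap e F x) (N (chart_inv e x)) = 0].

(* The equation says [dF (A v) = - dN v] for all tangent vectors [v]; its
   solution is unique because [dmap e F x] is row-free, and exists by
   [shape_operatorP]. *)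
Definition shape_operator (R : realType) (M : surface R)
    (F N : M -> space R) (e : chart R M) (x : plane R) : 'M[R]_2 :=
  xget 0 [set A : 'M[R]_2 | A *m dmap e F x = - dmap e N x].

Definition angle_fun (R : realType) (M : surface R) (k : space R)
    (N : M -> space R) (p : M) : R := angle (N p) k.

(* As above, uniqueness by row-freeness and existence by [tangent_partP], when
   [k] is a unit vector. *)
Definition tangent_part (R : realType) (M : surface R) (k : space R)
    (F N : M -> space R) (e : chart R M) (x : plane R) : plane R :=
  xget 0 [set u : plane R |
    k = u *m dmap e F x +
        cos (angle_fun k N (chart_inv e x)) *: N (chart_inv e x)].

Definition minimal (R : realType) (M : surface R) (F N : M -> space R) :
    Prop :=
  forall e x, atlas e -> chart_cod e x -> \tr (shape_operator F N e x) = 0.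

Definition U_principal (R : realType) (M : surface R) (k : space R)
    (F N : M -> space R) : Prop :=
  forall e x, atlas e -> chart_cod e x ->
    exists lambda : R,
      tangent_part k F N e x *m shape_operator F N e x =
      lambda *: tangent_part k F N e x.

Definition vec2 (R : realType) (x y : R) : plane R :=
  \row_(i < 2) [:: x; y]`_i.

Definition vec3 (R : realType) (x y z : R) : space R :=
  \row_(i < 3) [:: x; y; z]`_i.

Definition ambient_isometry (R : realType) (G : space R -> space R) : Prop :=
  forall u v, enorm (G u - G v) = enorm (u - v).

Definition carries_direction (R : realType) (G : space R -> space R)
    (u w : space R) : Prop :=
  forall v, G (v + u) - G v = w.

Definition catenoid (R : realType) (c x y : R) : space R :=
  let s := Num.sqrt (x ^+ 2 + c ^+ 2) in
  vec3 (s * cos y) (s * sin y) (c * ln (x + s)).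

Definition locally_catenoid (R : realType) (M : surface R) (k : space R)
    (F : M -> space R) : Prop :=
  forall p : M, exists (c : R) (G : space R -> space R) (e : chart R M),
    [/\ c != 0,
        ambient_isometry G,
        carries_direction G k (vec3 0 0 1),
        coordinate_chart e /\ chart_dom e p &
        forall x y, chart_cod e (vec2 x y) ->
          G (F (chart_inv e (vec2 x y))) = catenoid c x y].

Section shape_operator_exists.
Context (R : realType) (M : surface R) (k : space R) (F N : M -> space R).
Hypotheses (F_isom : isometric_immersion F) (N_normal : unit_normal F N).
Variables (e : chart R M) (x : plane R).
Hypotheses (atlas_e : atlas e) (cod_x : chart_cod e x).

Let n := N (chart_inv e x).

Let dF_normal : dmap e F x *m n^T = 0.
Proof.
have [_ _ orth] := N_normal.
apply/row_matrixP => i; rewrite row0 row_mul rowE.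
apply/matrixP => a b; rewrite !ord1 !mxE.
by have := orth e x atlas_e cod_x (delta_mx 0 i); rewrite /dot mxE.
Qed.

Lemma tangent_plane : (dmap e F x :=: kermx n^T)%MS.
Proof.
have [_ nn _] := N_normal.
have [freeF _] := F_isom.2 e x atlas_e cod_x.
apply/eqmxP; rewrite -(geq_leqif (mxrank_leqif_eq _)); last first.
  by apply/sub_kermxP.
rewrite mxrank_ker mxrank_tr (eqP freeF).
suff -> : \rank n = 1%N by [].
apply/eqP; rewrite eqn_leq rank_leq_row lt0n mxrank_eq0.
apply/eqP => n0; have := nn (chart_inv e x).
by rewrite -/n n0 /dot mul0mx mxE => /eqP; rewrite eq_sym oner_eq0.
Qed.

Let dN_normal : dmap e N x *m n^T = 0.
Proof.
have [Nsm nn _] := N_normal.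
have [_ oe _ _ _] := atlas_chart atlas_e.
pose f := local_expr e N.
have df : differentiable f x by have [/(_ x cod_x)] := Nsm e atlas_e 1%N.
apply/row_matrixP => i; rewrite row0 row_mul rowE.
rewrite -deriveEjacobian//; set v := delta_mx 0 i.
have dfv : derivable f x v by exact: diff_derivable.
have dfc j : derivable (fun y => f y 0 j : R^o) x v.
  by have /derivable_mxP := dfv; apply.
have : 'D_v (fun y => dot (f y) (f y) : R^o) x = 0.
  rewrite (_ : (fun y => _) = cst 1) ?derive_cst//.
  by apply/funext => y; exact: nn.
rewrite (_ : (fun y => _) = \sum_(j < 3) (fun y => f y 0 j * f y 0 j : R^o)).
  rewrite derive_sum; last by move=> j; exact: derivableM.
  under eq_bigr => j _ do rewrite deriveM//.
  move=> h; apply/matrixP => a b; rewrite !ord1 !mxE.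
  apply/eqP; set t := (X in X == _).
  have : t *+ 2 == 0.
    rewrite mulr2n -[X in _ == X]h /t -big_split/=; apply/eqP/eq_bigr => j _.
    by rewrite derive_mx// !mxE /GRing.scale/= [X in X + _]mulrC
      [X in _ + X]mulrC.
  by rewrite mulrn_eq0.
apply/funext => y; rewrite /dot mxE fct_sumE.
by apply: eq_bigr => j _; rewrite !mxE.
Qed.

Lemma shape_operatorP :
  shape_operator F N e x *m dmap e F x = - dmap e N x.
Proof.
rewrite /shape_operator; apply: (@xgetPex _ 0 [set A : 'M[R]_2 |
  A *m dmap e F x = - dmap e N x]).
exists (- dmap e N x *m pinvmx (dmap e F x)) => /=.
rewrite mulmxKpV// tangent_plane.
by apply/sub_kermxP; rewrite mulNmx dN_normal oppr0.
Qed.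

Hypothesis k_unit : dot k k = 1.

Lemma cos_angle_fun p : cos (angle_fun k N p) = dot (N p) k.
Proof.
have [_ nn _] := N_normal.
rewrite /angle_fun /angle /enorm k_unit nn sqrtr1 mulr1 divr1 acosK//.
have dotE (u v : space R) : dot u v = \sum_(i < 3) u 0 i * v 0 i.
  by rewrite /dot mxE; apply: eq_bigr => i _; rewrite !mxE.
have := nn p; have := k_unit; rewrite !dotE => k1 n1.
move: k1 n1; rewrite !big_ord_recl !big_ord0 !addr0 in_itv/=.
move: (N p 0 _) (N p 0 _) (N p 0 _) (k 0 _) (k 0 _) (k 0 _).
move=> a b c a' b' c' k1 n1.
have hp := addr_ge0 (addr_ge0 (sqr_ge0 (a + a')) (sqr_ge0 (b + b')))
  (sqr_ge0 (c + c')).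
have hm := addr_ge0 (addr_ge0 (sqr_ge0 (a - a')) (sqr_ge0 (b - b')))
  (sqr_ge0 (c - c')).
by apply/andP; split; lra.
Qed.

Lemma tangent_partP :
  k = tangent_part k F N e x *m dmap e F x +
      cos (angle_fun k N (chart_inv e x)) *: N (chart_inv e x).
Proof.
have [_ nn _] := N_normal.
rewrite /tangent_part; rewrite cos_angle_fun -/n; apply: (@xgetPex _ 0 [set u : 'rV[R]_2 |
  k = u *m dmap e F x + dot n k *: n]).
exists ((k - dot n k *: n) *m pinvmx (dmap e F x)).
rewrite /= mulmxKpV ?subrK// tangent_plane; apply/sub_kermxP.
apply/matrixP => a b; rewrite !ord1 mulmxBl -scalemxAl.
have n1 : (n *m n^T) 0 0 = 1 := nn _.
have -> : dot n k = (k *m n^T) 0 0.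
  by rewrite /dot -[n *m _]trmxK trmx_mul trmxK mxE.
by move: n1; rewrite !mxE => ->; rewrite mulr1 subrr.
Qed.

End shape_operator_exists.

(* Main.v *)
Require Import Defs.
From HB Require Import structures.
From mathcomp Require Import all_boot all_order all_algebra.
From mathcomp Require Import all_classical all_reals all_analysis.
From mathcomp Require Import ring lra.
Set Implicit Arguments.
Unset Strict Implicit.
Unset Printing Implicit Defensive.
Import Order.TTheory GRing.Theory Num.Theory.
Import numFieldNormedType.Exports.
Local Open Scope classical_set_scope.
Local Open Scope ring_scope.

(** Write [h = <N, k> = cos theta], [Z = <F, k>], [U = k - h N] and
    [s^2 = |U|^2 = 1 - h^2], which is positive everywhere.

    The shape operator is self-adjoint, so being traceless with [U] as an
    eigenvector means being a multiple of the reflection of the tangent plane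
    that negates [U]. Thus [M] is minimal with [U] principal if and only if
    at each point there is a number [kappa] such that, for every tangent [v],
      [dN(v) = kappa (s^2 dF(v) - 2 dZ(v) U)]
    (the predicate [catenoidal_at], and [catenoidal_atP]). Both implications of
    the theorem go through this equation.

    From the equation to the catenoid. Its factor [kappa] is constant: the
    symmetry of the second derivatives of [N] gives
      [dkappa(w) rho(v) = dkappa(v) rho(w)]
    where [rho(v) = s^2 dF(v) - 2 dZ(v) U] is injective ([codazzi]), so
    [dkappa = 0] on each chart, and the surface is connected
    ([catenoidal_factor_constant]). The constant [C] is not 0, for otherwise [N]
    and the angle function would be constant. The equation then integrates
    explicitly. Since [dh = - C s^2 dZ], the horizontal parts of [F] and of
    [C^-1 N / s^2] differ by a constant, which locates the axis
    ([axis_integral]); and with [x = - C^-1 h / s] and [c = 1 / |C|] one has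
    [dx = dZ / s] and [sqrt (x^2 + c^2) = c / s], so that [Z] and
    [c ln (x + sqrt (x^2 + c^2))] differ by a constant ([height_integral]). The
    first integral says that the distance to the axis is [c / s] and that the
    polar angle [y] around the axis is the one of the horizontal part of [N], up
    to its sign. In a frame with third vector [k] this is the formula of the
    catenoid. Finally [(x, y)] has injective differential because [F] is an
    immersion that factors through it, so it is a coordinate system by the
    inverse function theorem ([local_inverse], [catenoid_coordinates]).

    From the catenoid to the equation. The catenoid has an explicit unit normal
    field, which satisfies the equation with [kappa = 1 / c]
    ([catenoid_normal_catenoidal]); the given [N] is locally this field or its
    opposite, up to the isometry ([catenoid_catenoidal_at]), and the equation
    does not depend on the chart ([catenoidal_at_change]). *)

(** * Derivatives and their calculation rules *)

(** Differentiability together with the values of all directional derivatives,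
    so that one rule per operation yields both. *)
Definition has_diff (R : realType) (V W : normedModType R) (f : V -> W)
    (x : V) (df : V -> W) : Prop :=
  differentiable f x /\ forall v, 'D_v f x = df v.

Section has_diff_rules.
Context (R : realType) (V : normedModType R).
Implicit Types (W : normedModType R) (x v : V).

Lemma has_diffP W (f : V -> W) x : differentiable f x ->
  has_diff f x (fun v => 'D_v f x).
Proof. by []. Qed.

Lemma has_diff_eq W (f : V -> W) x df df' :
  has_diff f x df -> df =1 df' -> has_diff f x df'.
Proof. by move=> [? h] e; split=> // v; rewrite h e. Qed.

Lemma near_has_diff W (f g : V -> W) x df :
  (\near x, f x = g x) -> has_diff f x df -> has_diff g x df.
Proof.
move=> fg [f' Df]; split; last first.
  by move=> v; rewrite -Df; apply/esym/near_eq_derive.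
have fgx := nbhs_singleton fg.
apply/diff_locallyP.
have [c eqf] := proj1 (diff_locallyP _ _) f'.
suff e : g \o shift x = cst (g x) + 'd f x +o_ 0 id.
  by rewrite (diff_unique c e).
apply/eqaddoP => e e0.
have /eqaddoP/(_ e e0) := eqf.
have : \forall y \near 0, f (y + x) = g (y + x).
  by have := fg; rewrite (near_shift 0 x); rewrite subr0; apply.
apply: filterS2 => y hy; rewrite /= /cst.
by rewrite -[(g \o _ - _) y]/(g (y + x) - (g x + _)) -hy -fgx.
Qed.

Lemma has_diff_cst W (a : W) x : has_diff (fun=> a) x (fun=> 0).
Proof. by split=> [|v]; [exact: differentiable_cst|exact: derive_cst]. Qed.

Lemma has_diff_id x : has_diff id x id.
Proof. by split=> // v; exact: derive_id. Qed.

Lemma has_diffD W (f g : V -> W) x df dg :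
  has_diff f x df -> has_diff g x dg ->
  has_diff (fun y => f y + g y) x (fun v => df v + dg v).
Proof.
move=> [f' Df] [g' Dg]; split=> [|v]; first exact: differentiableD.
by rewrite -Df -Dg; apply: deriveD; exact: diff_derivable.
Qed.

Lemma has_diffB W (f g : V -> W) x df dg :
  has_diff f x df -> has_diff g x dg ->
  has_diff (fun y => f y - g y) x (fun v => df v - dg v).
Proof.
move=> [f' Df] [g' Dg]; split=> [|v]; first exact: differentiableB.
by rewrite -Df -Dg; apply: deriveB; exact: diff_derivable.
Qed.

Lemma has_diff_sum W n (f : 'I_n -> V -> W) x df :
  (forall i, has_diff (f i) x (df i)) ->
  has_diff (fun y => \sum_i f i y) x (fun v => \sum_i df i v).
Proof.
move=> h; rewrite (_ : (fun y => _) = \sum_i f i); last first.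
  by apply/funext => y; rewrite fct_sumE.
split=> [|v]; first by apply: differentiable_sum => i; case: (h i).
rewrite derive_sum; first by apply: eq_bigr => i _; case: (h i).
by move=> i; apply: diff_derivable; case: (h i).
Qed.

Lemma has_diffM (f g : V -> R) x df dg :
  has_diff f x df -> has_diff g x dg ->
  has_diff (fun y => f y * g y) x (fun v => df v * g x + f x * dg v).
Proof.
move=> [f' Df] [g' Dg]; split=> [|v]; first exact: differentiableM.
rewrite -Df -Dg; rewrite [LHS]deriveM; last 2 first.
- exact: diff_derivable.
- exact: diff_derivable.
by rewrite addrC /GRing.scale/= [X in X + _]mulrC.
Qed.

Lemma has_diff_scale W (f : V -> R) (a : W) x df : has_diff f x df ->
  has_diff (fun y => f y *: a) x (fun v => df v *: a).
Proof.
move=> [f' Df]; split=> [|v]; first exact: differentiableZl.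
by rewrite deriveE ?diffZl //= -?deriveE ?Df //; exact: differentiableZl.
Qed.

Lemma has_diff_comp (W W' : normedModType R) (f : V -> W) (g : W -> W') x df dg :
  has_diff f x df -> has_diff g (f x) dg ->
  has_diff (fun y => g (f y)) x (fun v => dg (df v)).
Proof.
move=> [f' Df] [g' Dg]; split=> [|v]; first exact: (differentiable_comp f' g').
rewrite -Dg -Df !deriveE //; last exact: (differentiable_comp f' g').
by rewrite [in LHS](diff_comp f' g').
Qed.

Lemma has_diff_comp1 (f : V -> R) (g : R -> R) x df dg :
  has_diff f x df -> is_derive (f x) 1 g dg ->
  has_diff (fun y => g (f y)) x (fun v => dg * df v).
Proof.
move=> hf hg; apply: (has_diff_comp (dg := fun t => dg * t)) hf _.
have g' : differentiable g (f x) by apply/derivable1_diffP.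
split=> // t; rewrite deriveE // -[t]mulr1 [LHS]linearZ/= -deriveE // derive_val.
by rewrite /GRing.scale/= mulrC mulr1.
Qed.

Lemma has_diffV (f : V -> R) x df : has_diff f x df -> f x != 0 ->
  has_diff (fun y => (f y)^-1) x (fun v => - (f x ^- 2) * df v).
Proof.
move=> [f' Df] fx; split=> [|v]; first exact: differentiableV.
by rewrite -Df deriveE ?diffV //= -?deriveE //; exact: differentiableV.
Qed.

Lemma has_diff_coord m n (f : V -> 'M[R]_(m.+1, n.+1)) x df i j : has_diff f x df ->
  has_diff (fun y => f y i j) x (fun v => df v i j).
Proof.
move=> [f' Df]; split=> [|v].
  exact: (differentiable_comp f' (differentiable_coord _ _ _)).
by rewrite -Df derive_mx ?mxE//; exact: diff_derivable.
Qed.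

Lemma has_diff_row n (f : V -> 'rV[R]_n.+1) x (df : V -> 'rV[R]_n.+1) :
  (forall j, has_diff (fun y => f y 0 j) x (fun v => df v 0 j)) ->
  has_diff f x df.
Proof.
move=> h.
have e (u : 'rV[R]_n.+1) : u = \sum_j u 0 j *: delta_mx 0 j.
  exact: row_sum_delta.
rewrite (_ : f = fun y => \sum_j f y 0 j *: delta_mx 0 j); last first.
  by apply/funext => y; exact: e.
apply: has_diff_eq.
  by apply: has_diff_sum => j; apply: has_diff_scale; exact: h.
by move=> v /=; rewrite -e.
Qed.

End has_diff_rules.

(** * Functions of class C^n *)

Section C_on_calculus.
Context (R : realType).
Implicit Types (V W : normedModType R).

Lemma C_on_ext V W n (D : set V) (f g : V -> W) : open D ->
  (forall x, D x -> f x = g x) -> C_on n D f -> C_on n D g.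
Proof.
move=> oD; elim: n f g => [|n IH] f g fg /=.
  move=> fc x Dx; have fgx : \near x, f x = g x.
    by have := open_nbhs_nbhs (conj oD Dx); apply: filterS.
  rewrite /prop_for/continuous_at -fg//.
  by apply: cvg_trans (fc x Dx); apply: near_eq_cvg.
have fgx x : D x -> \near x, f x = g x.
  by move=> Dx; have := open_nbhs_nbhs (conj oD Dx); apply: filterS.
move=> [df dfn]; split=> [x Dx|v].
  by have [] := near_has_diff (fgx x Dx) (has_diffP (df x Dx)).
by apply: IH (dfn v) => x Dx; apply: near_eq_derive; exact: fgx.
Qed.

Lemma C_on_sub V W n (D E : set V) (f : V -> W) : E `<=` D ->
  C_on n D f -> C_on n E f.
Proof.
move=> ED; elim: n f => [|n IH] f /=; first by move=> h x /ED/h.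
by move=> [h1 h2]; split=> [x /ED/h1//|v]; exact: IH.
Qed.

Lemma C_onW V W n (D : set V) (f : V -> W) : C_on n.+1 D f -> C_on n D f.
Proof.
elim: n f => [|n IH] f [h1 h2].
  by move=> x /h1/differentiable_continuous.
by split=> // v; apply: IH.
Qed.

Lemma C_on_cst V W n (D : set V) (a : W) : C_on n D (fun=> a).
Proof.
elim: n a => [|n IH] a /=; first by move=> x _; exact: cst_continuous.
split=> [x _|v]; first exact: differentiable_cst.
have -> : (fun x => 'D_v ((fun=> a) : V -> W) x) = fun=> 0 by
  apply/funext => x; exact: derive_cst.
exact: IH.
Qed.

(** A formula for the derivatives gains one order of smoothness. The basic
    closure properties below are inductions on the order through this lemma, the
    formula for the derivative being each time built from functions whose
    smoothness is already known at the lower order. *)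
Lemma C_onS V W n (D : set V) (f : V -> W) (df : V -> V -> W) : open D ->
  (forall x, D x -> has_diff f x (df x)) ->
  (forall v, C_on n D (df^~ v)) -> C_on n.+1 D f.
Proof.
move=> oD h h'; split=> [x /h[]//|v].
by apply: C_on_ext (h' v) => // x /h[_ ->].
Qed.

Lemma C_on_has_diff V W n (D : set V) (f : V -> W) x : C_on n.+1 D f -> D x ->
  has_diff f x (fun v => 'D_v f x).
Proof. by move=> [h _] /h/has_diffP. Qed.

Lemma C_onD V W n (D : set V) (f g : V -> W) : open D ->
  C_on n D f -> C_on n D g -> C_on n D (fun x => f x + g x).
Proof.
move=> oD; elim: n f g => [|n IH] f g hf hg.
  by move=> x Dx; apply: cvgD; [exact: hf|exact: hg].
apply: (C_onS oD) => [x Dx|v].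
  by apply: has_diffD; [exact: C_on_has_diff hf Dx|exact: C_on_has_diff hg Dx].
exact: IH (hf.2 v) (hg.2 v).
Qed.

Lemma C_on_sum V W n (I : finType) (D : set V) (f : I -> V -> W) : open D ->
  (forall i, C_on n D (f i)) -> C_on n D (fun x => \sum_i f i x).
Proof.
move=> oD hf; rewrite (_ : (fun x => _) = \sum_i f i); last first.
  by apply/funext => x; rewrite fct_sumE.
elim/big_ind: _ => //; first exact: C_on_cst.
by move=> g h hg hh; exact: C_onD.
Qed.

Lemma C_onM V n (D : set V) (f g : V -> R) : open D ->
  C_on n D f -> C_on n D g -> C_on n D (fun x => f x * g x).
Proof.
move=> oD; elim: n f g => [|n IH] f g hf hg.
  by move=> x Dx; apply: cvgM; [exact: hf|exact: hg].
apply: (C_onS oD) => [x Dx|v].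
  by apply: has_diffM; [exact: C_on_has_diff hf Dx|exact: C_on_has_diff hg Dx].
exact: C_onD oD (IH _ _ (hf.2 v) (C_onW hg)) (IH _ _ (C_onW hf) (hg.2 v)).
Qed.

Lemma C_onN V n (D : set V) (f : V -> R) : open D ->
  C_on n D f -> C_on n D (fun x => - f x).
Proof.
move=> oD hf; under eq_fun do rewrite -mulN1r.
by apply: C_onM => //; exact: C_on_cst.
Qed.

Lemma C_on_scale V W n (D : set V) (f : V -> R) (a : W) : open D ->
  C_on n D f -> C_on n D (fun x => f x *: a).
Proof.
move=> oD; elim: n f => [|n IH] f hf.
  by move=> x Dx; apply: cvgZl; exact: hf.
apply: (C_onS oD) => [x Dx|v].
  by apply: has_diff_scale; exact: C_on_has_diff hf Dx.
exact: IH (hf.2 v).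
Qed.

Lemma C_on_coord V n p q (D : set V) (f : V -> 'M[R]_(p.+1, q.+1)) i j : open D ->
  C_on n D f -> C_on n D (fun x => f x i j).
Proof.
move=> oD; elim: n f => [|n IH] f hf.
  move=> x Dx; apply: (@continuous_comp _ _ _ f
    (fun M : 'M[R]_(_, _) => M i j) x (hf x Dx)).
  exact: coord_continuous.
apply: (C_onS oD) => [x Dx|v].
  by apply: has_diff_coord; exact: C_on_has_diff hf Dx.
exact: IH (hf.2 v).
Qed.

Lemma C_on_row V n q (D : set V) (f : V -> 'rV[R]_q.+1) : open D ->
  (forall j, C_on n D (fun x => f x 0 j)) -> C_on n D f.
Proof.
move=> oD hf; rewrite (_ : f = fun x => \sum_j f x 0 j *: delta_mx 0 j); last first.
  by apply/funext => x; exact: row_sum_delta.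
by apply: C_on_sum => // j; exact: C_on_scale.
Qed.

Lemma C_on_comp V n q (D : set V) (E : set 'rV[R]_q.+1) (f : V -> 'rV[R]_q.+1)
    (g : 'rV[R]_q.+1 -> R) : open D -> (forall x, D x -> E (f x)) ->
  C_on n D f -> C_on n E g -> C_on n D (fun x => g (f x)).
Proof.
move=> oD fE; elim: n f g fE => [|n IH] f g fE hf hg.
  by move=> x Dx; apply: (@continuous_comp _ _ _ f g x (hf x Dx)); apply: hg; exact: fE.
apply: (C_onS (df := fun x v => \sum_j 'D_v f x 0 j * 'D_(delta_mx 0 j) g (f x))
  oD) => [x Dx|v].
  have hgx := C_on_has_diff hg (fE x Dx).
  apply: has_diff_eq (has_diff_comp (C_on_has_diff hf Dx) hgx) _ => v /=.
  have g' : differentiable g (f x) := hgx.1.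
  rewrite deriveE//.
  rewrite [in LHS](row_sum_delta ('D_v f x)) linear_sum.
  apply: eq_bigr => j _; by rewrite linearZ -[in LHS]deriveE.
have := @C_on_sum V R n _ D
  (fun j x => 'D_v f x 0 j * 'D_(delta_mx 0 j) g (f x)) oD.
apply=> j.
apply: C_onM => //.
  by apply: C_on_coord => //; exact: hf.2.
exact: (IH f _ fE (C_onW hf) (hg.2 _)).
Qed.

(** The induction closes up because the derivative of the inverse is a
    polynomial in the inverse itself and the derivative of [f]; the same
    happens for [C_on_rsqrt]. *)
Lemma C_onV V n (D : set V) (f : V -> R) : open D ->
  (forall x, D x -> f x != 0) -> C_on n D f -> C_on n D (fun x => (f x)^-1).
Proof.
move=> oD f0; elim: n f f0 => [|n IH] f f0 hf.
  by move=> x Dx; apply: cvgV; [exact: f0|exact: hf].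
have hV : C_on n D (fun x => (f x)^-1) by apply: IH => //; exact: C_onW.
apply: (C_onS oD) => [x Dx|v].
  by apply: has_diffV; [exact: C_on_has_diff hf Dx|exact: f0].
under eq_fun do rewrite -exprVn expr2.
apply: C_onM => //; last exact: hf.2.
by apply: C_onN => //; exact: C_onM.
Qed.

Lemma has_diff_rsqrt V (f : V -> R) x df : has_diff f x df -> 0 < f x ->
  has_diff (fun y => (Num.sqrt (f y))^-1) x
    (fun v => - 2^-1 * (Num.sqrt (f x))^-1 ^+ 3 * df v).
Proof.
move=> hf fx; have s0 : Num.sqrt (f x) != 0 by rewrite sqrtr_eq0 -ltNge.
apply: has_diff_eq (has_diffV (has_diff_comp1 hf (is_derive1_sqrt fx)) s0) _.
by move=> v; field.
Qed.

Lemma C_on_rsqrt V n (D : set V) (f : V -> R) : open D ->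
  (forall x, D x -> 0 < f x) -> C_on n D f ->
  C_on n D (fun x => (Num.sqrt (f x))^-1).
Proof.
move=> oD f0; elim: n f f0 => [|n IH] f f0 hf.
  move=> x Dx; apply: cvgV; first by rewrite sqrtr_eq0 -ltNge f0.
  by apply: (@continuous_comp _ _ _ f Num.sqrt x (hf x Dx)); exact: sqrt_continuous.
have hV : C_on n D (fun x => (Num.sqrt (f x))^-1) by apply: IH => //; exact: C_onW.
apply: (C_onS oD) => [x Dx|v].
  by apply: has_diff_rsqrt; [exact: C_on_has_diff hf Dx|exact: f0].
apply: C_onM => //; last exact: hf.2.
apply: C_onM => //; first exact: C_on_cst.
under eq_fun do rewrite !exprS expr0 mulr1.
by do 2 apply: C_onM => //.
Qed.

Lemma has_diff_atan V (f : V -> R) x df : has_diff f x df ->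
  has_diff (fun y => atan (f y)) x (fun v => (1 + f x ^+ 2)^-1 * df v).
Proof. by move=> hf; exact: has_diff_comp1 hf _. Qed.

Lemma C_on_atan V n (D : set V) (f : V -> R) : open D ->
  C_on n D f -> C_on n D (fun x => atan (f x)).
Proof.
move=> oD; case: n => [|n] hf.
  by move=> x Dx; apply: (@continuous_comp _ _ _ f atan x (hf x Dx)); exact: continuous_atan.
apply: (C_onS oD) => [x Dx|v].
  by apply: has_diff_atan; exact: C_on_has_diff hf Dx.
apply: C_onM => //; last exact: hf.2.
apply: C_onV => // [x Dx|].
  by rewrite gt_eqF// ltr_pwDl// sqr_ge0.
apply: C_onD => //; first exact: C_on_cst.
by under eq_fun do rewrite expr2; apply: C_onM => //; exact: C_onW.
Qed.

End C_on_calculus.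

(** * Mean value theorems and Schwarz's theorem *)

Section mean_value.
Context (R : realType) (V : normedModType R).
Implicit Types (x v w : V).

Lemma mean_value_segment (g : V -> R) (a v : V) :
  (forall t : R, 0 <= t <= 1 -> differentiable g (a + t *: v)) ->
  exists2 t : R, 0 <= t <= 1 & g (a + v) - g a = 'D_v g (a + t *: v).
Proof.
move=> dg; pose phi (t : R) := g (a + t *: v).
have dphi (t : R) : 0 <= t <= 1 -> is_derive t (1 : R) phi ('D_v g (a + t *: v)).
  move=> t01; have h : has_diff (fun t : R => a + t *: v) t (fun s => s *: v).
    apply: has_diff_eq (has_diffD (has_diff_cst a t) (has_diff_scale v (has_diff_id t))) _.
    by move=> s; rewrite add0r.
  have [d1 d2] := has_diff_comp h (has_diffP (dg t t01)).
  apply: DeriveDef; first exact: diff_derivable.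
  by rewrite d2 scale1r.
have [||t] := @MVT_segment R phi (fun t => 'D_v g (a + t *: v)) 0 1 ler01.
- by move=> t; rewrite in_itv/= => /andP[t0 t1]; apply: dphi; rewrite !ltW.
- apply: derivable_within_continuous => t; rewrite in_itv/= => /dphi h.
  exact: ex_derive.
rewrite in_itv/= subr0 mulr1 /phi scale1r scale0r addr0 => t01 ->.
by exists t.
Qed.

Lemma derive0_ball_constant (g : V -> R) (x : V) (r : R) :
  (forall y, ball x r y -> has_diff g y (fun=> 0)) ->
  forall y, ball x r y -> g y = g x.
Proof.
move=> dg y; rewrite -ball_normE/= => xy.
have [|t t01] := @mean_value_segment g x (y - x).
  move=> t /andP[t0 t1]; apply: (dg _ _).1.
  rewrite -ball_normE/= opprD addrA subrr sub0r normrN normrZ ger0_norm//.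
  by rewrite distrC in xy; apply: le_lt_trans xy; rewrite ler_piMl.
rewrite subrKC (dg _ _).2 => [/eqP|]; first by rewrite subr_eq0 => /eqP.
case/andP: t01 => t0 t1.
rewrite -ball_normE/= opprD addrA subrr sub0r normrN normrZ ger0_norm//.
by rewrite distrC in xy; apply: le_lt_trans xy; rewrite ler_piMl.
Qed.

(** The mean value theorem is used twice: for [y |-> g (y + w) - g y] along
    [v], then for ['D_v g] along [w]. *)
Lemma mean_value_parallelogram (D : set V) (g : V -> R) x v w :
  C_on 2 D g ->
  (forall s t : R, 0 <= s <= 1 -> 0 <= t <= 1 -> D (x + s *: v + t *: w)) ->
  exists s t : R, [/\ 0 <= s <= 1, 0 <= t <= 1 &
    g (x + v + w) - g (x + v) - (g (x + w) - g x) =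
    'D_w (fun y => 'D_v g y) (x + s *: v + t *: w)].
Proof.
move=> [dg dg2] hD.
have u01 : 0 <= (1 : R) <= 1 by rewrite ler01 lexx.
have z01 : 0 <= (0 : R) <= 1 by rewrite ler01 lexx.
have hsh y : D (y + w) ->
    has_diff (fun y => g (y + w)) y (fun v => 'D_v g (y + w)).
  move=> Dy; have h : has_diff (fun y => y + w) y id.
    apply: has_diff_eq (has_diffD (has_diff_id y) (has_diff_cst w y)) _.
    by move=> u; rewrite addr0.
  exact: has_diff_comp h (has_diffP (dg _ Dy)).
have hG (s : R) : 0 <= s <= 1 -> has_diff (fun y => g (y + w) - g y) (x + s *: v)
    (fun v' => 'D_v' g (x + s *: v + w) - 'D_v' g (x + s *: v)).
  move=> s01; apply: has_diffB.
    by apply: hsh; have := hD s 1 s01 u01; rewrite scale1r.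
  by apply/has_diffP/dg; have := hD s 0 s01 z01; rewrite scale0r addr0.
have [s s01 es] := mean_value_segment (fun s h => (hG s h).1).
have [t t01 et] := @mean_value_segment (fun y => 'D_v g y) (x + s *: v) w
  (fun t h => (dg2 v).1 _ (hD s t s01 h)).
by exists s, t; split=> //; rewrite -et -(hG s s01).2 -es.
Qed.

Lemma deriveZdir (W : normedModType R) (f : V -> W) x (t : R) v :
  differentiable f x -> 'D_(t *: v) f x = t *: 'D_v f x.
Proof. by move=> df; rewrite !deriveE// linearZ. Qed.

(** Schwarz's theorem: both iterated derivatives are limits of the same second
    difference. *)
Lemma derive_comm (D : set V) (g : V -> R) x v w :
  open D -> D x -> C_on 2 D g ->
  'D_w (fun y => 'D_v g y) x = 'D_v (fun y => 'D_w g y) x.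
Proof.
move=> oD Dx g2.
have c2 a b : {for x, continuous (fun y => 'D_b (fun z => 'D_a g z) y)}.
  exact: (g2.2 a).2.
apply/eqP; rewrite -subr_eq0 -normr_le0; apply/ler_addgt0Pr => e e0.
rewrite add0r.
have e2 : 0 < e / 2 by rewrite divr_gt0.
pose h1 y := 'D_w (fun z => 'D_v g z) y.
pose h2 y := 'D_v (fun z => 'D_w g z) y.
have near1 : nbhs x [set y | `|h1 x - h1 y| < e / 2].
  by have /cvgrPdist_lt/(_ _ e2) := c2 v w.
have near2 : nbhs x [set y | `|h2 x - h2 y| < e / 2].
  by have /cvgrPdist_lt/(_ _ e2) := c2 w v.
have near3 : nbhs x D by exact: open_nbhs_nbhs.
have : nbhs x (D `&` ([set y | `|h1 x - h1 y| < e / 2] `&`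
    [set y | `|h2 x - h2 y| < e / 2])).
  by apply: filterI => //; apply: filterI.
move/nbhs_ballP => [d /= d0 hd].
pose M := `|v| + `|w| + 1.
have M0 : 0 < M by rewrite ltr_wpDl// addr_ge0.
(* At this scale the parallelogram of sides [t *: v] and [t *: w] fits in the
   ball. *)
have [t t0 tM] : exists2 t : R, 0 < t & t * M = d / 2.
  exists (d / (2 * M)); first by rewrite divr_gt0// mulr_gt0.
  by field; rewrite gt_eqF.
have inball (a b : R) : 0 <= a <= 1 -> 0 <= b <= 1 ->
    ball x d (x + a *: (t *: v) + b *: (t *: w)).
  move=> /andP[a0 a1] /andP[b0 b1]; rewrite -ball_normE/=.
  rewrite -addrA opprD addrA subrr sub0r normrN.
  apply: (@le_lt_trans _ _ (t * `|v| + t * `|w|)).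
    apply: le_trans (ler_normD _ _) _; rewrite !normrZ !ger0_norm ?(ltW t0)//.
    by apply: lerD; rewrite ler_piMl// mulr_ge0// ltW.
  have eM : t * M = t * `|v| + t * `|w| + t by rewrite /M; ring.
  move: tM t0 d0; rewrite eM; move: (t * `|v|) (t * `|w|) => A B; lra.
have inball' (a b : R) : 0 <= a <= 1 -> 0 <= b <= 1 ->
    ball x d (x + a *: (t *: w) + b *: (t *: v)).
  by move=> a01 b01; rewrite addrAC; exact: inball.
have second a b y : D y -> 'D_(t *: b) (fun y => 'D_(t *: a) g y) y =
    t ^+ 2 * 'D_b (fun y => 'D_a g y) y.
  move=> Dy; rewrite deriveZdir; last exact: ((g2.2 _).1 _ Dy).
  have /near_has_diff : \near y, t *: 'D_a g y = 'D_(t *: a) g y.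
    have : nbhs y D by exact: open_nbhs_nbhs.
    by apply: filterS => z Dz; rewrite deriveZdir//; exact: g2.1.
  have h := has_diffM (has_diff_cst t y) (has_diffP ((g2.2 a).1 _ Dy)).
  move=> /(_ _ h)[_ ->].
  by rewrite mul0r add0r expr2 -mulrA.
have [s1 [r1 [s101 r101 E1]]] := mean_value_parallelogram g2
  (fun a b ha hb => (let: conj h _ := hd _ (inball a b ha hb) in h)).
have [s2 [r2 [s201 r201 E2]]] := mean_value_parallelogram g2
  (fun a b ha hb => (let: conj h _ := hd _ (inball' a b ha hb) in h)).
have [D1 [b1 _]] := hd _ (inball _ _ s101 r101).
have [D2 [_ b2]] := hd _ (inball' _ _ s201 r201).
rewrite (second _ _ _ D1) in E1; rewrite (second _ _ _ D2) in E2.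
rewrite [x + t *: w + t *: v]addrAC in E2.
have e' := etrans (esym E1) (etrans (_ : _ = _) E2).
have {e'}/mulfI e' := e' ltac:(ring).
have {}e' := e' (lt0r_neq0 (exprn_gt0 2 t0)).
move: b1 b2 => /=; set y1 := x + _ + _; set y2 := x + _ + _ => b1 b2.
rewrite -[X in `|X - _|]/(h1 x) -[X in `|_ - X|]/(h2 x).
rewrite (_ : h1 x - h2 x = (h1 x - h1 y1) - (h2 x - h2 y2)); last first.
  by rewrite (_ : h1 y1 = h2 y2) ?opprB ?addrA ?addrNK// addrAC subrK.
apply: ltW; apply: le_lt_trans (ler_normB _ _) _.
by have := ltrD b1 b2; rewrite -splitr.
Qed.

End mean_value.

(** * The inverse function theorem *)

(** Row vectors form a Banach space, in which contractions have fixed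
    points. *)
HB.instance Definition _ (R : realType) (m n : nat) :=
  Uniform_isComplete.Build 'M[R]_(m, n) cauchy_cvg.

Section matrix_calculus.
Context (R : realType).
Implicit Types V W : normedModType R.

Lemma C_on_bigprod V n (I : finType) (D : set V) (f : I -> V -> R) : open D ->
  (forall i, C_on n D (f i)) -> C_on n D (fun x => \prod_i f i x).
Proof.
move=> oD hf; rewrite (_ : (fun x => _) = \big[(fun f g x => f x * g x)/(fun=> 1)]_i f i).
  elim/big_ind: _ => //; first exact: C_on_cst.
  by move=> g h hg hh; exact: C_onM.
apply/funext => x.
by elim/big_rec2: _ => // i y1 y2 _ ->.
Qed.

Lemma C_on_det V n m (D : set V) (A : V -> 'M[R]_m) : open D ->
  (forall i j, C_on n D (fun x => A x i j)) -> C_on n D (fun x => \det (A x)).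
Proof.
move=> oD hA; apply: C_on_sum => // s.
by apply: C_onM => //; [exact: C_on_cst|exact: C_on_bigprod].
Qed.

(** By Cramer's rule the entries are quotients of determinants. *)
Lemma C_on_invmx V n m (D : set V) (A : V -> 'M[R]_m) i j : open D ->
  (forall x, D x -> A x \in unitmx) ->
  (forall i j, C_on n D (fun x => A x i j)) ->
  C_on n D (fun x => invmx (A x) i j).
Proof.
move=> oD uA hA.
have : C_on n D (fun x => (\det (A x))^-1 * ((-1) ^+ (j + i) *
    \det (row' j (col' i (A x))))).
  apply: C_onM => //.
    apply: C_onV => //; last exact: C_on_det.
    by move=> x /uA; rewrite unitmxE unitfE.
  apply: C_onM => //; first exact: C_on_cst.
  apply: C_on_det => // p q.
  by under eq_fun do rewrite !mxE; exact: hA.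
by apply: C_on_ext => // x /uA ux; rewrite /invmx ux !mxE.
Qed.

Lemma has_diff_mulmxr n m (M : 'M[R]_(n.+1, m.+1)) (x : 'rV[R]_n.+1) :
  has_diff (fun v : 'rV[R]_n.+1 => v *m M) x (fun v => v *m M).
Proof.
apply: has_diff_row => j.
rewrite (_ : (fun y => _) = fun y : 'rV_n.+1 => \sum_i y 0 i * M i j); last first.
  by apply/funext => y; rewrite mxE.
have h i : has_diff (fun y : 'rV[R]_n.+1 => y 0 i * M i j : R) x
    (fun v => v 0 i * M i j).
  apply: has_diff_eq.
    apply: has_diffM (has_diff_cst (M i j) x).
    exact: has_diff_coord (has_diff_id x).
  by move=> v /=; rewrite mulr0 addr0.
apply: has_diff_eq (has_diff_sum h) _.
by [].
Qed.

Lemma mulmxr_continuous n m (M : 'M[R]_(n.+1, m.+1)) :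
  continuous (fun v : 'rV[R]_n.+1 => v *m M).
Proof.
by move=> x; apply: differentiable_continuous; case: (has_diff_mulmxr M x).
Qed.

Lemma mx_norm_entry n m (M : 'M[R]_(n.+1, m.+1)) i j : `|M i j| <= `|M|.
Proof.
rewrite [leRHS]/Num.Def.normr/= mx_normrE.
exact: (le_bigmax _ (fun i => `|M i.1 i.2|) (i, j)).
Qed.

Lemma mx_norm_le n m (M : 'M[R]_(n.+1, m.+1)) e : 0 <= e ->
  (forall i j, `|M i j| <= e) -> `|M| <= e.
Proof.
move=> e0 h; rewrite [leLHS]/Num.Def.normr/= mx_normrE.
by apply: bigmax_le => // -[i j] _ /=; exact: h.
Qed.

Lemma has_diff_intro V W (f : V -> W) (x : V) (df : {linear V -> W}) :
  continuous df ->
  (forall e : R, 0 < e ->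
    \forall h \near (0 : V), `|f (h + x) - (f x + df h)| <= e * `|h|) ->
  has_diff f x df.
Proof.
move=> c h; have eqf : f \o shift x = cst (f x) + df +o_ 0 id.
  by apply/eqaddoP => e /h.
have E := diff_unique c eqf.
have f' : differentiable f x by apply/diff_locallyP; rewrite E; split.
by split=> // v; rewrite deriveE// E.
Qed.

Lemma mulmxr_bounded n m (M : 'M[R]_(n.+1, m.+1)) :
  exists2 k, 0 < k & forall v : 'rV[R]_n.+1, `|v *m M| <= k * `|v|.
Proof.
pose df : {linear 'rV[R]_n.+1 -> 'rV[R]_m.+1} := mulmxr M.
have c : continuous df by exact: mulmxr_continuous.
by have [k k0 h] := linear_lipschitz c; exists k.
Qed.

End matrix_calculus.

Section inverse_function.
Context (R : realType) (n : nat).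
Local Notation E := 'rV[R]_n.+1.

(** The partial derivatives of [g] are continuous and vanish at [x0], so they
    are small nearby; the Lipschitz bound follows along segments. *)
Lemma small_derivative (D : set E) (g : E -> E) (x0 : E) :
  open D -> D x0 -> C_on 1 D g -> (forall v, 'D_v g x0 = 0) ->
  exists d : R, [/\ 0 < d, ball x0 d `<=` D,
    forall x v, ball x0 d x -> `|'D_v g x| <= 2^-1 * `|v| &
    forall a b, ball x0 d a -> ball x0 d b -> `|g a - g b| <= 2^-1 * `|a - b|].
Proof.
move=> oD Dx [dg cg] g0.
(* Each of the [n.+1] partial derivatives may contribute this much. *)
pose e : R := (2 * n.+1%:R)^-1.
have e0 : 0 < e by rewrite invr_gt0 mulr_gt0.
have near1 (i : 'I_n.+1) : \forall x \near x0, `|'D_(delta_mx 0 i) g x| < e.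
  have := cg (delta_mx 0 i) x0 Dx => /cvgrPdist_lt/(_ e e0).
  by rewrite g0; apply: filterS => x; rewrite sub0r normrN.
have near2 : \forall x \near x0, D x by exact: open_nbhs_nbhs.
have near3 : nbhs x0 [set x | forall i, `|'D_(delta_mx 0 i) g x| < e].
  exact: filter_forall near1.
have : nbhs x0 (D `&` [set x | forall i, `|'D_(delta_mx 0 i) g x| < e]).
  exact: filterI.
move=> /nbhs_ballP[d /= d0 hd].
have sumE (a : R) : \sum_(i < n.+1) a * e = 2^-1 * a.
  have eN : n.+1%:R * e = 2^-1 by rewrite /e invfM mulrCA divff ?mulr1.
  by rewrite sumr_const card_ord -[LHS]mulr_natl mulrCA eN mulrC.
have bd (x v : E) : ball x0 d x -> `|'D_v g x| <= 2^-1 * `|v|.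
  move=> /hd[Dx' h]; rewrite deriveE; last exact: dg.
  rewrite {1}(row_sum_delta v) linear_sum.
  apply: le_trans (ler_norm_sum _ _ _) _.
  apply: (@le_trans _ _ (\sum_(i < n.+1) `|v| * e)).
    apply: ler_sum => i _; rewrite linearZ/= normrZ -deriveE; last exact: dg.
    by apply: ler_pM => //; [exact: mx_norm_entry|exact: ltW].
  by rewrite le_eqVlt; apply/orP; left; apply/eqP; exact: sumE.
exists d; split=> // [x /hd[]//|a b ha hb].
have hseg (t : R) : 0 <= t <= 1 -> ball x0 d (b + t *: (a - b)).
  move=> /andP[t0 t1]; move: ha hb; rewrite -ball_normE/= => ha hb.
  rewrite (_ : x0 - _ = (1 - t) *: (x0 - b) + t *: (x0 - a)); last first.
    by apply/matrixP => i j; rewrite !mxE; ring.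
  apply: le_lt_trans (ler_normD _ _) _.
  rewrite !normrZ !ger0_norm ?subr_ge0//.
  move: ha hb; set A := `|_ - a|; set B := `|_ - b| => ha hb.
  have [->|t'] := eqVneq t 0; first by rewrite mul0r subr0 mul1r addr0.
  have t0' : 0 < t by rewrite lt_neqAle eq_sym t'.
  have : (1 - t) * B <= (1 - t) * d by rewrite ler_wpM2l ?subr_ge0// ltW.
  have : t * A < t * d by rewrite ltr_pM2l.
  lra.
apply: mx_norm_le => [|i j]; first by rewrite mulr_ge0.
rewrite ord1 !mxE.
have hj y : ball x0 d y -> has_diff (fun y => g y 0 j) y (fun v => 'D_v g y 0 j).
  by move=> /hd[Dy _]; exact: has_diff_coord (has_diffP (dg _ Dy)).
have [t /hseg ht] := mean_value_segment (fun t ht => (hj _ (hseg t ht)).1).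
rewrite subrKC => ->; rewrite (hj _ ht).2.
by apply: le_trans (mx_norm_entry _ _ _) _; exact: bd.
Qed.

(** Solving [x - g x = y] is finding a fixed point of [x |-> y + g x], which
    is a contraction of the closed ball of radius [d / 2]. *)
Lemma contraction_shift_surj (g : E -> E) (x0 : E) (d : R) : 0 < d ->
  (forall a b, ball x0 d a -> ball x0 d b -> `|g a - g b| <= 2^-1 * `|a - b|) ->
  forall y, ball (x0 - g x0) (d / 4) y -> exists2 x, ball x0 d x & x - g x = y.
Proof.
move=> d0 lip y yb.
pose U := closed_ball x0 (d / 2).
have d2 : 0 < d / 2 by rewrite divr_gt0.
have UE : U = [set x | `|x0 - x| <= d / 2] by rewrite /U closed_ballE.
have Ub x : U x -> ball x0 d x.
  rewrite UE /= -ball_normE/= => /le_lt_trans; apply.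
  by rewrite ltr_pdivrMr// ltr_pMr// ltrDl.
have bx0 : ball x0 d x0 by exact: ballxx.
pose f x := y + g x.
have fU : set_fun U U f.
  move=> x Ux; rewrite UE/=.
  have -> : x0 - f x = (x0 - g x0 - y) + (g x0 - g x).
    by apply/matrixP => i j; rewrite /f !mxE; ring.
  apply: le_trans (ler_normD _ _) _.
  move: yb; rewrite -ball_normE/= => yb.
  have h1 := lip _ _ bx0 (Ub _ Ux).
  have h2 : `|x0 - x| <= d / 2 by move: Ux; rewrite UE.
  move: yb h1 h2; set a := `|_ - y|; set b := `|g x0 - _|; set c := `|x0 - x|; lra.
pose fisfun := isFun.Build _ _ _ _ f fU.
pose ff : {fun U >-> U} := HB.pack f fisfun.
have cf : is_contraction ff.
  exists (2^-1)%:nng; split=> /=; first by rewrite invf_lt1// ltr1n.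
  move=> [a b] [/= Ua Ub']; rewrite /f opprD addrACA subrr add0r.
  by apply: lip; exact: Ub.
have [x Ux xf] : exists2 x, U x & x = ff x.
  apply: banach_fixed_point cf _ _; first exact: closed_ball_closed.
  by exists x0; rewrite UE/= subrr normr0 ltW.
by exists x; [exact: Ub|rewrite {1}xf /= /f addrK].
Qed.

(** The inverse function theorem. Composing [Phi] with the inverse of its
    Jacobian at [x0] gives [x - g x] where [g] has derivative 0 at [x0], hence is
    a contraction nearby; this makes [Phi] injective with open image, and its
    inverse Lipschitz. The Lipschitz bound gives the differentiability of the
    inverse [Psi], with derivative [invmx (J (Psi y))] at [y], and this formula
    raises the smoothness of [Psi] one order at a time. *)
Lemma local_inverse (D : set E) (Phi : E -> E) (x0 : E) :
  open D -> D x0 -> smooth_on D Phi -> (forall v, 'D_v Phi x0 = 0 -> v = 0) ->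
  exists (W : set E) (Psi : E -> E),
    [/\ open W, W x0 /\ W `<=` D, open (Phi @` W),
        forall x, W x -> Psi (Phi x) = x & smooth_on (Phi @` W) Psi].
Proof.
move=> oD Dx0 sPhi inj0.
have dPhi x : D x -> has_diff Phi x (fun v => 'D_v Phi x).
  by move=> Dx; exact: C_on_has_diff (sPhi 1%N) Dx.
pose J x : 'M[R]_n.+1 := jacobian Phi x.
have JE x v : D x -> 'D_v Phi x = v *m J x.
  by move=> Dx; rewrite deriveEjacobian//; case: (dPhi x Dx).
have uJ0 : J x0 \in unitmx.
  rewrite -row_free_unit -kermx_eq0; apply/eqP/row_matrixP => i.
  rewrite row0; apply: inj0; rewrite JE//.
  by rewrite -row_mul mulmx_ker row0.
pose L := invmx (J x0).
pose g x := x - Phi x *m L.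
have dg x : D x -> has_diff g x (fun v => v - 'D_v Phi x *m L).
  move=> Dx; apply: has_diffB; first exact: has_diff_id.
  exact: has_diff_comp (dPhi x Dx) (has_diff_mulmxr L (Phi x)).
have g1 : C_on 1 D g.
  apply: (C_onS oD dg) => v x Dx.
  have c : {for x, continuous (fun x => 'D_v Phi x *m L)}.
    apply: (@continuous_comp _ _ _ (fun x => 'D_v Phi x) (fun u => u *m L)).
      exact: (sPhi 1%N).2.
    exact: mulmxr_continuous.
  by apply: continuousB c; exact: cst_continuous.
have g0 v : 'D_v g x0 = 0.
  by rewrite (dg _ Dx0).2 JE// mulmxK// subrr.
have [d [d0 bD bdg lip]] := small_derivative oD Dx0 g1 g0.
have uJ x : ball x0 d x -> J x \in unitmx.
  move=> bx; rewrite -row_free_unit -kermx_eq0; apply/eqP/row_matrixP => i.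
  rewrite row0; set v := row i _.
  have vJ : v *m J x = 0 by rewrite /v -row_mul mulmx_ker row0.
  have := bdg x v bx; rewrite (dg _ (bD _ bx)).2 JE ?vJ; last exact: bD.
  rewrite mul0mx subr0 => h; apply/eqP; rewrite -normr_le0.
  by move: h; set t := `|v|; lra.
have PhiE x : Phi x *m L = x - g x by rewrite /g subKr.
have expand a b : ball x0 d a -> ball x0 d b ->
    `|a - b| <= 2 * `|(Phi a - Phi b) *m L|.
  move=> ba bb; have h := lip a b ba bb.
  rewrite mulmxBl !PhiE.
  have := ler_normD (a - g a - (b - g b)) (g a - g b).
  have -> : a - g a - (b - g b) + (g a - g b) = a - b.
    by apply/matrixP => i j; rewrite !mxE; ring.
  by move: h; set t := `|g a - _|; set s := `|a - b|; lra.
have [k k0 hk] := mulmxr_bounded L.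
have expandk a b : ball x0 d a -> ball x0 d b ->
    `|a - b| <= 2 * k * `|Phi a - Phi b|.
  move=> ba bb; apply: le_trans (expand _ _ ba bb) _.
  by rewrite -mulrA ler_wpM2l.
pose B := [set y : E | ball (x0 - g x0) (d / 4) (y *m L)].
have oB : open B.
  apply: open_comp; last exact: ball_open.
  by move=> y _; exact: mulmxr_continuous.
pose W := [set x | ball x0 d x /\ B (Phi x)].
have imW : Phi @` W = B.
  apply/seteqP; split=> [_ [x [_ Bx] <-]//|y By].
  have [x bx ex] := contraction_shift_surj d0 lip By.
  have exy : Phi x = y.
    by rewrite -[LHS](mulmxKV uJ0) -/L PhiE ex mulmxKV.
  by exists x => //; split=> //; rewrite exy.
pose Psi y := xget x0 [set x | W x /\ Phi x = y].
have PsiP y : B y -> W (Psi y) /\ Phi (Psi y) = y.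
  rewrite -imW => -[x Wx ex].
  by apply: (@xgetPex _ x0 [set x | W x /\ Phi x = y]); exists x.
have PsiK x : W x -> Psi (Phi x) = x.
  move=> Wx; have [[b1 _] e1] := PsiP _ Wx.2.
  apply/eqP; rewrite -subr_eq0 -normr_le0.
  by apply: le_trans (expandk _ _ b1 Wx.1) _; rewrite e1 subrr normr0 mulr0.
exists W, Psi.
have oW : open W.
  rewrite openE => x [bx Bx]; apply: filterI.
    by apply: open_nbhs_nbhs; split; [exact: ball_open|exact: bx].
  have /differentiable_continuous c := (dPhi x (bD _ bx)).1.
  by apply: c; apply: open_nbhs_nbhs; split.
have dPsi y : B y -> has_diff Psi y (fun v => v *m invmx (J (Psi y))).
  move=> By; have [[bx _] ex] := PsiP _ By; set x := Psi y in bx ex *.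
  pose M := invmx (J x); pose df : {linear E -> E} := mulmxr M.
  apply: (@has_diff_intro _ _ _ _ _ df); first exact: mulmxr_continuous.
  move=> e e0.
  have [m m0 hm] := mulmxr_bounded M.
  pose e' := e / (m * (2 * k)).
  have e'0 : 0 < e' by rewrite divr_gt0// !mulr_gt0.
  have nB : \forall h \near (0 : E), B (h + y).
    have : \forall z \near y, B z by exact: open_nbhs_nbhs (conj oB By).
    by rewrite (near_shift 0 y) subr0.
  have : \forall h \near (0 : E), `|Phi (h + x) - (Phi x + h *m J x)| <= e' * `|h|.
    have /diff_locallyP[_ /eqaddoP/(_ e' e'0)] := (dPhi x (bD _ bx)).1.
    by apply: filterS => h; rewrite -JE ?deriveE//; [case: (dPhi x (bD _ bx))|exact: bD].
  move=> /nbhs_ballP[r /= r0 hr].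
  have nr : \forall h \near (0 : E), `|h| < r / (2 * k).
    apply/nbhs_ballP; exists (r / (2 * k)) => /=; first by rewrite divr_gt0// mulr_gt0.
    by move=> h; rewrite -ball_normE/= sub0r normrN.
  near=> h.
  have Bh : B (h + y) by near: h.
  have [[bz _] ez] := PsiP _ Bh; set z := Psi (h + y) in bz ez *.
  have zx : `|z - x| <= 2 * k * `|h|.
    by apply: le_trans (expandk _ _ bz bx) _; rewrite ez ex addrK.
  have : `|Phi ((z - x) + x) - (Phi x + (z - x) *m J x)| <= e' * `|z - x|.
    apply: hr; rewrite -ball_normE/= sub0r normrN.
    apply: le_lt_trans zx _; rewrite mulrC -ltr_pdivlMr ?mulr_gt0//.
    by near: h.
  rewrite subrK ez ex => hh.
  have -> : z - (x + df h) = - ((h + y - (y + (z - x) *m J x)) *m M).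
    rewrite mulmxBl mulmxDl [(y + _) *m _]mulmxDl -mulmxA mulmxV ?uJ// mulmx1.
    by rewrite /df /= /mulmxr; apply/matrixP => i j; rewrite !mxE; ring.
  rewrite normrN; apply: le_trans (hm _) _.
  apply: (@le_trans _ _ (m * (e' * (2 * k * `|h|)))).
    by rewrite ler_pM2l//; apply: le_trans hh _; rewrite ler_pM2l.
  rewrite /e' le_eqVlt; apply/orP; left; apply/eqP; field.
  by rewrite !gt_eqF.
split=> //.
- split=> [|x [/bD]//]; split; first exact: ballxx.
  by rewrite /B/= PhiE; apply: ballxx; rewrite divr_gt0.
- by rewrite imW.
rewrite imW => m.
elim: m => [y /dPsi[/differentiable_continuous]//|m IH].
apply: (C_onS oB dPsi) => v; apply: C_on_row => // j.
have : C_on m B (fun y => \sum_i v 0 i * invmx (J (Psi y)) i j).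
  apply: C_on_sum => // i; apply: C_onM => //; first exact: C_on_cst.
  apply: (@C_on_comp _ _ _ _ B W Psi (fun x => invmx (J x) i j)) => //.
    by move=> y /PsiP[].
  apply: (@C_on_invmx R _ m n.+1 W J i j oW) => [x [/uJ]//|p q].
  have : C_on m W (fun x => 'D_(delta_mx 0 p) Phi x 0 q).
    apply: C_on_coord => //; apply: (@C_on_sub _ _ _ _ D) => [x [/bD]//|].
    exact: (sPhi m.+1).2.
  apply: C_on_ext => // x [/bD Dx _]; rewrite JE// /J.
  by rewrite -rowE mxE.
by apply: C_on_ext => // y By; rewrite mxE.
Unshelve. all: by end_near. Qed.

End inverse_function.

(** * Scalar products, charts and the local model *)

Section dot_theory.
Context (R : realType) (n : nat).
Implicit Types u v w : 'rV[R]_n.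

Lemma dotE u v : dot u v = \sum_i u 0 i * v 0 i.
Proof. by rewrite /dot mxE; apply: eq_bigr => i _; rewrite mxE. Qed.

Lemma dotC u v : dot u v = dot v u.
Proof. by rewrite !dotE; apply: eq_bigr => i _; rewrite mulrC. Qed.

Lemma dotDl u v w : dot (u + v) w = dot u w + dot v w.
Proof. by rewrite /dot mulmxDl mxE. Qed.

Lemma dotZl a u v : dot (a *: u) v = a * dot u v.
Proof. by rewrite /dot -scalemxAl mxE. Qed.

Lemma dotNl u v : dot (- u) v = - dot u v.
Proof. by rewrite /dot mulNmx mxE. Qed.

Lemma dotBl u v w : dot (u - v) w = dot u w - dot v w.
Proof. by rewrite dotDl dotNl. Qed.

Lemma dotDr u v w : dot u (v + w) = dot u v + dot u w.
Proof. by rewrite !(dotC u) dotDl. Qed.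

Lemma dotZr a u v : dot u (a *: v) = a * dot u v.
Proof. by rewrite !(dotC u) dotZl. Qed.

Lemma dotNr u v : dot u (- v) = - dot u v.
Proof. by rewrite !(dotC u) dotNl. Qed.

Lemma dotBr u v w : dot u (v - w) = dot u v - dot u w.
Proof. by rewrite dotDr dotNr. Qed.

Lemma dot0l v : dot 0 v = 0.
Proof. by rewrite /dot mul0mx mxE. Qed.

Lemma dot_ge0 u : 0 <= dot u u.
Proof. by rewrite dotE; apply: sumr_ge0 => i _; rewrite -expr2 sqr_ge0. Qed.

End dot_theory.

Section has_diff_dot.
Context (R : realType) (V : normedModType R) (n : nat).

Lemma has_diff_dot (f g : V -> 'rV[R]_n.+1) x df dg :
  has_diff f x df -> has_diff g x dg ->
  has_diff (fun y => dot (f y) (g y)) x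
    (fun v => dot (df v) (g x) + dot (f x) (dg v)).
Proof.
move=> hf hg.
have h i : has_diff (fun y => f y 0 i * g y 0 i) x
    (fun v => df v 0 i * g x 0 i + f x 0 i * dg v 0 i).
  by apply: has_diffM; exact: has_diff_coord.
rewrite (_ : (fun y => _) = (fun y => \sum_i f y 0 i * g y 0 i)); last first.
  by apply/funext => y; rewrite dotE.
apply: has_diff_eq (has_diff_sum h) _ => v /=.
by rewrite !dotE -big_split.
Qed.

Lemma has_diff_dotl (f : V -> 'rV[R]_n.+1) x df m : has_diff f x df ->
  has_diff (fun y => dot (f y) m) x (fun v => dot (df v) m).
Proof.
move=> hf; apply: has_diff_eq (has_diff_dot hf (has_diff_cst m x)) _ => v /=.
by rewrite (dotC _ 0) dot0l addr0.
Qed.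

End has_diff_dot.

Section charts.
Context (R : realType) (M : topologicalType).
Implicit Types e : chart R M.

Lemma chart_codP e x : is_chart e -> chart_cod e x ->
  chart_dom e (chart_inv e x) /\ chart_map e (chart_inv e x) = x.
Proof. by move=> [_ _ K _ _] [p dp <-]; rewrite K. Qed.

Lemma chart_cod_map e p : chart_dom e p -> chart_cod e (chart_map e p).
Proof. by exists p. Qed.

Lemma overlapP e1 e2 x : is_chart e1 ->
  overlap e1 e2 x <-> chart_cod e1 x /\ chart_dom e2 (chart_inv e1 x).
Proof.
move=> c1; split=> [[p [d1 d2] <-]|[cx dx]].
  by split; [exact: chart_cod_map|case: c1 => _ _ -> //].
by have [d1 <-] := chart_codP c1 cx; exists (chart_inv e1 x).
Qed.

Lemma overlap_open e1 e2 : is_chart e1 -> is_chart e2 -> open (overlap e1 e2).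
Proof.
move=> c1 c2; rewrite openE => x /(overlapP _ _ c1)[cx dx].
have [_ oc1 _ _ ci1] := c1; have [od2 _ _ _ _] := c2.
have h1 : nbhs x (chart_cod e1) by exact: open_nbhs_nbhs.
have h2 : nbhs x (chart_inv e1 @^-1` chart_dom e2).
  by apply: ci1 => //; exact: open_nbhs_nbhs.
have : nbhs x (chart_cod e1 `&` chart_inv e1 @^-1` chart_dom e2) by exact: filterI.
by apply: filterS => z [hz1 hz2]; apply/overlapP.
Qed.

Lemma local_expr_change e1 e2 (f : M -> 'rV[R]_3) x df :
  is_chart e1 -> is_chart e2 -> compatible e1 e2 -> overlap e1 e2 x ->
  has_diff (local_expr e2 f) (transition e1 e2 x) df ->
  has_diff (local_expr e1 f) x (fun v => df ('D_v (transition e1 e2) x)).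
Proof.
move=> c1 c2 [s12 _] ox hf.
have ht := C_on_has_diff (s12 1%N) ox.
apply: near_has_diff (has_diff_comp ht hf).
have := open_nbhs_nbhs (conj (overlap_open c1 c2) ox).
apply: filterS => z /(overlapP _ _ c1)[cz dz].
by rewrite /local_expr /transition; case: c2 => _ _ ->.
Qed.

End charts.

(** Let [U = k - <n, k> n] and [s^2 = |U|^2 = 1 - <n, k>^2]. The right-hand side
    is [kappa s^2] times the image of ['D_v f x] under the reflection of the
    tangent plane that negates [U]. As ['D_v n] is the opposite of the shape
    operator, the principal curvatures are then [kappa s^2] along [U] and
    [- kappa s^2] across it. The factor [s^2] is set apart because Codazzi's
    equation makes the remaining factor constant; on a catenoid [kappa] is
    [1 / c] or [- 1 / c] according to the side of the normal. *)
Definition catenoidal_at (R : realType) (k : 'rV[R]_3)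
    (f n : 'rV[R]_2 -> 'rV[R]_3) (x : 'rV[R]_2) (kappa : R) : Prop :=
  forall v, 'D_v n x = kappa *:
    ((1 - dot (n x) k ^+ 2) *: 'D_v f x -
     (2 * dot ('D_v f x) k) *: (k - dot (n x) k *: n x)).

Section algebra.
Context (R : realType).

(** If [s] is not 0, the eigenvalues of [A] are [l], on the column [v], and
    [- l], on the kernel of [u]. *)
Lemma trace0_eigen2 (A : 'M[R]_2) (u : 'rV[R]_2) (v : 'cV[R]_2) (l s : R) :
  \tr A = 0 -> u *m A = l *: u -> A *m v = l *: v -> (u *m v) 0 0 = s ->
  s *: A = (2 * l) *: (v *m u) - (s * l)%:M.
Proof.
move=> trA uA Av uv.
have sum2 (F : 'I_2 -> R) : \sum_i F i = F 0 + F 1.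
  by rewrite big_ord_recl big_ord1; congr (_ + F _); apply/val_inj.
move: trA uv; rewrite /mxtrace mxE !sum2 => trA uv.
have uA0 : u 0 0 * A 0 0 + u 0 1 * A 1 0 = l * u 0 0.
  by have /matrixP/(_ 0 0) := uA; rewrite !mxE sum2.
have uA1 : u 0 0 * A 0 1 + u 0 1 * A 1 1 = l * u 0 1.
  by have /matrixP/(_ 0 1) := uA; rewrite !mxE sum2.
have Av0 : A 0 0 * v 0 0 + A 0 1 * v 1 0 = l * v 0 0.
  by have /matrixP/(_ 0 0) := Av; rewrite !mxE sum2.
have Av1 : A 1 0 * v 0 0 + A 1 1 * v 1 0 = l * v 1 0.
  by have /matrixP/(_ 1 0) := Av; rewrite !mxE sum2.
have ord2 (i : 'I_2) : i = 0 \/ i = 1.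
  by case: i => [[|[|//]] hi]; [left|right]; apply/val_inj.
apply/matrixP => i j; rewrite !mxE big_ord1 -uv.
move: trA uA0 uA1 Av0 Av1.
have [->|->] := ord2 i; have [->|->] := ord2 j; rewrite /= ?mulr1n ?mulr0n ?subr0.
all: move: (u 0 0) (u 0 1) (v 0 0) (v 1 0) (A 0 0) (A 0 1) (A 1 0) (A 1 1).
all: move=> u0 u1 v0 v1 a b c d /eqP; rewrite addrC addr_eq0 => /eqP-> E1 E2 E3 E4.
(* Each entry is a combination of two of the four eigenvector equations. *)
- have := congr1 ( *%R (v0)) E1; have := congr1 ( *%R (- u1)) E4; lra.
- have := congr1 ( *%R (v0)) E2; have := congr1 ( *%R (u1)) E3; lra.
- have := congr1 ( *%R (v1)) E1; have := congr1 ( *%R (u0)) E4; lra.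
- have := congr1 ( *%R (v1)) E2; have := congr1 ( *%R (- u0)) E3; lra.
Qed.

End algebra.

(** * The shape operator of a minimal surface *)

(** Linear algebra in one tangent plane: [a] and [b] are the differentials of
    the immersion and of the normal, [A] is the shape operator and [u] the
    tangent part of [k]. The self-adjointness of [A] turns the eigenvector
    equation for the row [u] into one for the column [a *m k^T], and a
    traceless [A] is determined by the pair. Conversely [A] can be read off the
    formula for [b] because [a] has full rank. *)
Lemma weingarten_reflection (R : realType) (k n : 'rV[R]_3) (a b : 'M[R]_(2, 3))
    (A : 'M[R]_2) (u : 'rV[R]_2) :
  dot k k = 1 -> 0 < 1 - dot n k ^+ 2 -> row_free a -> A *m a = - b ->
  u *m a = k - dot n k *: n -> a *m n^T = 0 -> b *m a^T = a *m b^T ->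
  (\tr A = 0 /\ exists l, u *m A = l *: u) <->
  exists kappa, forall w, w *m b = kappa *:
    ((1 - dot n k ^+ 2) *: (w *m a) - (2 * dot (w *m a) k) *: (k - dot n k *: n)).
Proof.
move=> k1 s_gt0 fa AE ua an0 sym.
pose v := a *m k^T; set s := 1 - _ in s_gt0 *.
have uv : (u *m v) 0 0 = s.
  by rewrite /v mulmxA ua -[LHS]/(dot _ k) dotBl dotZl k1 -expr2.
have s0 : s != 0 by rewrite gt_eqF.
have vE w : (w *m v) 0 0 = dot (w *m a) k by rewrite /v mulmxA.
split=> [[trA [l ul]]|[kap hk]].
- have vgu : v = a *m a^T *m u^T.
    have kE : k = u *m a + dot n k *: n by rewrite ua subrK.
    rewrite /v {1}kE linearD/= mulmxDr trmx_mul mulmxA linearZ/= -scalemxAr.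
    by rewrite an0 scaler0 addr0.
  have Asym : A *m (a *m a^T) = (a *m a^T) *m A^T.
    by rewrite mulmxA AE -mulmxA -trmx_mul AE mulNmx linearN/= mulmxN sym.
  have Av : A *m v = l *: v.
    by rewrite vgu mulmxA Asym -mulmxA -trmx_mul ul linearZ/= -scalemxAr.
  have AA := trace0_eigen2 trA ul Av uv.
  exists (l / s) => w.
  have -> : w *m b = - (w *m (A *m a)) by rewrite AE mulmxN opprK.
  apply: (scalerI s0); rewrite scalerN scalemxAr scalemxAl AA.
  rewrite mulmxBl mulmxBr -scalemxAl -scalemxAr -mulmxA ua mul_scalar_mx.
  rewrite -scalemxAr mulmxA.
  rewrite [w *m v]mx11_scalar vE mul_scalar_mx.
  by apply/rowP => j; rewrite !mxE; field; exact: s0.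
- have AE' : A = kap *: (2 *: (v *m u) - s%:M).
    have [B aB] := row_freeP fa.
    rewrite -[A]mulmx1 -[RHS]mulmx1 -aB !mulmxA; congr (_ *m B).
    rewrite AE; apply/row_matrixP => i.
    rewrite linearN/= rowE hk rowE.
    rewrite -!scalemxAl -scalemxAr mulmxBl mulmxBr -scalemxAl -scalemxAr.
    rewrite -mulmxA ua mul_scalar_mx -scalemxAr mulmxA.
    rewrite [delta_mx 0 i *m v]mx11_scalar vE mul_scalar_mx.
    by apply/rowP => j; rewrite !mxE; ring.
  split.
    rewrite AE' linearZ/= linearB/= linearZ/= mxtrace_mulC mxtrace_scalar.
    rewrite [u *m v]mx11_scalar uv mxtrace_scalar.
    by rewrite mulr1n mulr2n; ring.
  exists (kap * s).
  rewrite AE' -scalemxAr mulmxBr -scalemxAr mulmxA [u *m v]mx11_scalar uv.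
  rewrite mul_scalar_mx mul_mx_scalar.
  by apply/rowP => j; rewrite !mxE; ring.
Qed.

Section immersed.
Context (R : realType) (M : surface R) (k : 'rV[R]_3) (F N : M -> 'rV[R]_3).
Hypotheses (k_unit : dot k k = 1) (F_isom : isometric_immersion F).
Hypothesis N_normal : unit_normal F N.
Hypothesis theta_range : forall p : M, 0 < angle_fun k N p < pi.

Lemma normal_height_lt1 p : 0 < 1 - dot (N p) k ^+ 2.
Proof.
rewrite -(cos_angle_fun N_normal k_unit).
have := sin_gt0_pi (theta_range p); have := cos2Dsin2 (angle_fun k N p).
by move=> <- s0; rewrite addrAC subrr add0r exprn_gt0.
Qed.

Section in_atlas.
Variables (e : chart R M).
Hypothesis ae : atlas e.
Let f := local_expr e F.
Let n := local_expr e N.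
Let D := chart_cod e.

Lemma atlas_cod_open : open D.
Proof. by case: (atlas_chart ae). Qed.

Lemma immersion_smooth : smooth_on D f.
Proof. exact: F_isom.1. Qed.

Lemma normal_smooth : smooth_on D n.
Proof. by case: N_normal => + _ _; exact. Qed.

Lemma has_diff_immersion x : D x -> has_diff f x (fun v => 'D_v f x).
Proof. exact: C_on_has_diff (immersion_smooth 1%N). Qed.

Lemma has_diff_normal x : D x -> has_diff n x (fun v => 'D_v n x).
Proof. exact: C_on_has_diff (normal_smooth 1%N). Qed.

Lemma immersionE x v : D x -> 'D_v f x = v *m dmap e F x.
Proof. by move=> Dx; rewrite deriveEjacobian//; case: (has_diff_immersion Dx). Qed.

Lemma normalE x v : D x -> 'D_v n x = v *m dmap e N x.
Proof. by move=> Dx; rewrite deriveEjacobian//; case: (has_diff_normal Dx). Qed.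

Lemma immersion_inj x v : D x -> 'D_v f x = 0 -> v = 0.
Proof.
move=> Dx; rewrite immersionE// => v0.
have [/row_freeP[B aB] _] := F_isom.2 _ _ ae Dx.
by rewrite -[v]mulmx1 -aB mulmxA v0 mul0mx.
Qed.

Lemma normal_ortho x v : D x -> dot ('D_v f x) (n x) = 0.
Proof. by move=> Dx; rewrite immersionE//; case: N_normal => _ _; exact. Qed.

Lemma derive_immersion_comm x v w : D x ->
  'D_w (fun y => 'D_v f y) x = 'D_v (fun y => 'D_w f y) x.
Proof.
move=> Dx; apply/rowP => j; have oD := atlas_cod_open.
have h a b : 'D_b (fun y => 'D_a f y) x 0 j =
    'D_b (fun y => 'D_a (fun z => f z 0 j) y) x.
  have h2 : C_on 1 D (fun y => 'D_a f y) := (immersion_smooth 2).2 a.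
  rewrite -(has_diff_coord 0 j (C_on_has_diff h2 Dx)).2.
  apply: near_eq_derive; have := open_nbhs_nbhs (conj oD Dx).
  apply: filterS => z Dz.
  by rewrite (has_diff_coord 0 j (has_diff_immersion Dz)).2.
have fj2 : C_on 2 D (fun z => f z 0 j).
  exact: C_on_coord oD (immersion_smooth 2).
exact: etrans (h v w) (etrans (derive_comm v w oD Dx fj2) (esym (h w v))).
Qed.

(** The shape operator is self-adjoint: differentiating the orthogonality of
    [n] and ['D_w f] shows that both sides equal [- dot ('D_v 'D_w f x) (n x)]. *)
Lemma second_form_sym x v w : D x ->
  dot ('D_v n x) ('D_w f x) = dot ('D_w n x) ('D_v f x).
Proof.
move=> Dx; have oD := atlas_cod_open.
have h a b : dot ('D_a n x) ('D_b f x) =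
    - dot ('D_a (fun y => 'D_b f y) x) (n x).
  have h2 : C_on 1 D (fun y => 'D_b f y) := (immersion_smooth 2).2 b.
  have {}h2 := C_on_has_diff h2 Dx.
  have [_ /(_ a)] := has_diff_dot h2 (has_diff_normal Dx).
  have -> : 'D_a (fun y => dot ('D_b f y) (n y)) x = 0.
    have [_ ->//] : has_diff (fun y => dot ('D_b f y) (n y)) x (fun=> 0).
      apply: near_has_diff (has_diff_cst 0 x).
      have := open_nbhs_nbhs (conj oD Dx).
      by apply: filterS => z Dz; rewrite normal_ortho.
  by move/eqP; rewrite eq_sym addrC addr_eq0 => /eqP; rewrite dotC.
apply: etrans (h v w) (etrans _ (esym (h w v))).
exact: (congr1 (fun t => - dot t (n x)) (derive_immersion_comm w v Dx)).
Qed.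

Let a x := dmap e F x.
Let A x := shape_operator F N e x.
Let u x := tangent_part k F N e x.
Let h x := dot (n x) k.

Lemma tangent_partE x : D x -> u x *m a x = k - h x *: n x.
Proof.
move=> Dx; have := tangent_partP F_isom N_normal ae Dx k_unit.
by rewrite (cos_angle_fun N_normal k_unit) => /(congr1 (fun t => t - h x *: n x)) ->; rewrite addrK.
Qed.

Lemma catenoidal_atP x : D x ->
  (\tr (A x) = 0 /\ exists l, u x *m A x = l *: u x) <->
  exists kappa, catenoidal_at k f n x kappa.
Proof.
move=> Dx.
have AE := shape_operatorP F_isom N_normal ae Dx.
have an0 : a x *m (n x)^T = 0.
  apply/row_matrixP => i; rewrite row_mul row0 rowE -immersionE//.
  by apply/rowP => j; rewrite !ord1 [RHS]mxE; exact: normal_ortho.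
have sym : dmap e N x *m (a x)^T = a x *m (dmap e N x)^T.
  apply/matrixP => i j.
  have E (p q : 'M[R]_(2, 3)) : 
      (p *m q^T) i j = dot (delta_mx 0 i *m p) (delta_mx 0 j *m q).
    by rewrite -!rowE dotE mxE; apply: eq_bigr => t _; rewrite !mxE.
  apply: etrans (E _ _) (etrans _ (etrans (dotC _ _) (esym (E _ _)))).
  have E' v w : dot (v *m dmap e N x) (w *m a x) = dot ('D_v n x) ('D_w f x).
    exact: congr2 (esym (normalE v Dx)) (esym (immersionE w Dx)).
  have S := second_form_sym (delta_mx 0 i) (delta_mx 0 j) Dx.
  exact: etrans (E' _ _) (etrans S (esym (E' _ _))).
have [fa _] := F_isom.2 _ _ ae Dx.
have hlt := normal_height_lt1 (chart_inv e x).
apply: iff_trans (weingarten_reflection k_unit hlt fa AE (tangent_partE Dx) an0 sym) _.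
split=> -[kap hk]; exists kap => w; have := hk w.
  rewrite (normalE w Dx) (immersionE w Dx); exact.
rewrite (normalE w Dx) (immersionE w Dx); exact.
Qed.

End in_atlas.
End immersed.

(** * Codazzi's equation and the first integrals *)

Section has_diff_more.
Context (R : realType) (V : normedModType R).

Lemma has_diff_cstM (f : V -> R) x df (c : R) : has_diff f x df ->
  has_diff (fun y => c * f y) x (fun v => c * df v).
Proof.
move=> hf; apply: has_diff_eq (has_diffM (has_diff_cst c x) hf) _ => v /=.
by rewrite mul0r add0r.
Qed.

Lemma has_diff_sqr (f : V -> R) x df : has_diff f x df ->
  has_diff (fun y => f y ^+ 2) x (fun v => 2 * f x * df v).
Proof.
move=> hf; rewrite (_ : (fun y => _) = fun y => f y * f y); last first.
  by apply/funext => y; rewrite expr2.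
by apply: has_diff_eq (has_diffM hf hf) _ => v /=; ring.
Qed.

(** The logarithm is [asinh (f y / |c|)], up to a constant. *)
Lemma has_diff_asinh (f : V -> R) x df (c : R) : c != 0 -> has_diff f x df ->
  has_diff (fun y => ln (f y + Num.sqrt (f y ^+ 2 + c ^+ 2))) x
    (fun v => (Num.sqrt (f x ^+ 2 + c ^+ 2))^-1 * df v).
Proof.
move=> c0 hf; set q := f x ^+ 2 + c ^+ 2.
have c2 : 0 < c ^+ 2 by rewrite exprn_even_gt0.
have q0 : 0 < q by rewrite ltr_wpDl// sqr_ge0.
have s0 : 0 < Num.sqrt q by rewrite sqrtr_gt0.
have fs : 0 < f x + Num.sqrt q.
  have : `|f x| < Num.sqrt q.
    by rewrite -sqrtr_sqr ltr_sqrt// ltrDl.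
  by rewrite ltr_norml => /andP[h _]; rewrite -(opprK (f x)) addrC subr_gt0 ltrNl.
have hq := has_diffD (has_diff_sqr hf) (has_diff_cst (c ^+ 2) x).
have hs := has_diffD hf (has_diff_comp1 hq (is_derive1_sqrt q0)).
apply: has_diff_eq (has_diff_comp1 hs (is_derive1_ln fs)) _ => v /=.
by rewrite addr0 -/q; field; rewrite !gt_eqF.
Qed.

End has_diff_more.

Section local_surface.
Context (R : realType) (k : 'rV[R]_3) (f n : 'rV[R]_2 -> 'rV[R]_3).
Variable D : set 'rV[R]_2.
Hypotheses (k_unit : dot k k = 1) (oD : open D).
Hypotheses (f_smooth : smooth_on D f) (n_smooth : smooth_on D n).
Hypothesis f_immersion : forall x v, D x -> 'D_v f x = 0 -> v = 0.
Hypothesis U_tangent : forall x, D x ->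
  exists u, 'D_u f x = k - dot (n x) k *: n x.
Let h x := dot (n x) k.
Hypothesis h_lt1 : forall x, D x -> 0 < 1 - h x ^+ 2.

Let hf x (Dx : D x) : has_diff f x (fun v => 'D_v f x) :=
  C_on_has_diff (f_smooth 1%N) Dx.
Let hn x (Dx : D x) : has_diff n x (fun v => 'D_v n x) :=
  C_on_has_diff (n_smooth 1%N) Dx.
Let Z v x := dot ('D_v f x) k.

Lemma catenoidal_height x kap v : catenoidal_at k f n x kap ->
  dot ('D_v n x) k = - kap * (1 - h x ^+ 2) * Z v x.
Proof.
move=> ->; rewrite dotZl dotBl !dotZl dotBl dotZl k_unit /Z /h.
by move: (dot _ k) (dot _ k) => a b; ring.
Qed.

Let reflection v x := (1 - h x ^+ 2) *: 'D_v f x - (2 * Z v x) *: (k - h x *: n x).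

Lemma reflection_inj x v : D x -> reflection v x = 0 -> v = 0.
Proof.
move=> Dx r0; have s0 : 1 - h x ^+ 2 != 0 by rewrite gt_eqF ?h_lt1.
have Z0 : Z v x = 0.
  have : dot (reflection v x) k = - (1 - h x ^+ 2) * Z v x.
    rewrite dotBl !dotZl dotBl dotZl k_unit /Z /h.
    by move: (dot _ k) (dot _ k) => a b; ring.
  rewrite r0 dot0l => /esym/eqP; rewrite mulf_eq0 oppr_eq0 (negbTE s0)/=.
  by move/eqP.
move: r0; rewrite /reflection Z0 mulr0 scale0r subr0 => /eqP.
by rewrite scaler_eq0 (negbTE s0)/= => /eqP; exact: f_immersion.
Qed.

Section constant.
Variables (kap : 'rV[R]_2 -> R) (dkap : 'rV[R]_2 -> R) (x : 'rV[R]_2).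
Hypotheses (Dx : D x) (law : forall y, D y -> catenoidal_at k f n y (kap y)).
Hypothesis hkap : has_diff kap x dkap.

(** Codazzi's equation: the two mixed derivatives of [n] agree, and in their
    difference all the terms without a derivative of [kap] cancel. *)
Lemma codazzi v w : dkap w *: reflection v x = dkap v *: reflection w x.
Proof.
apply/rowP => j; rewrite ![in LHS]mxE ![in RHS]mxE.
pose ff a b := 'D_b (fun y => 'D_a f y) x 0 j.
have second (g : 'rV[R]_2 -> 'rV[R]_3) a : smooth_on D g ->
    has_diff (fun y => 'D_a g y) x (fun b => 'D_b (fun y => 'D_a g y) x).
  by move=> sg; apply: C_on_has_diff ((sg 2).2 a : C_on 1 D _) Dx.
have comm (g : 'rV[R]_2 -> 'rV[R]_3) a b : smooth_on D g ->
    'D_b (fun y => 'D_a g y) x = 'D_a (fun y => 'D_b g y) x.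
  move=> sg; apply/rowP => i.
  have hh a' b' : 'D_b' (fun y => 'D_a' g y) x 0 i =
      'D_b' (fun y => 'D_a' (fun z => g z 0 i) y) x.
    rewrite -((has_diff_coord 0 i (second g a' sg)).2 b').
    apply: near_eq_derive; have := open_nbhs_nbhs (conj oD Dx).
    apply: filterS => z Dz.
    exact: esym ((has_diff_coord 0 i (C_on_has_diff (sg 1%N) Dz)).2 a').
  have g2 : C_on 2 D (fun z => g z 0 i) by exact: C_on_coord oD (sg 2).
  exact: etrans (hh a b) (etrans (derive_comm a b oD Dx g2) (esym (hh b a))).
have hh := has_diff_dotl k (hn Dx).
have key a b : 'D_b (fun y => 'D_a n y) x 0 j =
    dkap b * ((1 - h x ^+ 2) * 'D_a f x 0 j - 2 * Z a x * (k 0 j - h x * n x 0 j)) +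
    kap x * (- 2 * h x * dot ('D_b n x) k * 'D_a f x 0 j + (1 - h x ^+ 2) * ff a b
      - 2 * dot ('D_b (fun y => 'D_a f y) x) k * (k 0 j - h x * n x 0 j)
      + 2 * Z a x * (dot ('D_b n x) k * n x 0 j + h x * 'D_b n x 0 j)).
  have H1 := has_diffM (has_diffB (has_diff_cst (1 : R) x) (has_diff_sqr hh))
    (has_diff_coord 0 j (second f a f_smooth)).
  have H2 := has_diffM (has_diff_cstM 2 (has_diff_dotl k (second f a f_smooth)))
    (has_diffB (has_diff_cst (k 0 j) x) (has_diffM hh (has_diff_coord 0 j (hn Dx)))).
  have H := has_diffM hkap (has_diffB H1 H2).
  have E : \near x, (fun y => kap y * ((1 - dot (n y) k ^+ 2) * 'D_a f y 0 j -
      2 * dot ('D_a f y) k * (k 0 j - dot (n y) k * n y 0 j))) x = 'D_a n x 0 j.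
    have := open_nbhs_nbhs (conj oD Dx).
    by apply: filterS => z Dz; rewrite (law Dz) !mxE.
  have [_ <-] := has_diff_coord 0 j (second n a n_smooth).
  have [_ ->] := near_has_diff E H.
  rewrite /ff /Z /h /=.
  move: ('D_b (fun y => 'D_a f y) x) => P; move: (P 0 j) (dot P k) => P1 P2.
  move: ('D_b n x) => Q; move: (Q 0 j) (dot Q k) => Q1 Q2.
  move: ('D_a f x) => S; move: (S 0 j) (dot S k) => S1 S2.
  move: (n x 0 j) (dot (n x) k) (kap x) (dkap b) (k 0 j) => n1 h1 k1 k2 k3.
  ring.
have := congr1 (fun M : 'rV[R]_3 => M 0 j) (comm n v w n_smooth).
move=> /(fun E => etrans (esym (key v w)) (etrans E (key w v))).
have -> : ff v w = ff w v by rewrite /ff (comm f v w f_smooth).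
rewrite (comm f v w f_smooth).
rewrite (catenoidal_height v (law Dx)) (catenoidal_height w (law Dx)).
have law0 a : 'D_a n x 0 j = kap x * ((1 - h x ^+ 2) * 'D_a f x 0 j -
    2 * Z a x * (k 0 j - h x * n x 0 j)) by rewrite (law Dx) !mxE.
rewrite (law0 v) (law0 w) {law0}.
move: (ff w v) (dot ('D_v (fun y => 'D_w f y) x) k) => P Q; move: (Z v x) (Z w x) (h x) => zv zw hx.
move: ('D_v f x 0 j) ('D_w f x 0 j) (k 0 j) (n x 0 j) (kap x) => a b kj nj kp.
move=> E; apply/eqP; rewrite -subr_eq0; apply/eqP.
move/eqP: E; rewrite -subr_eq0 => /eqP E; rewrite -[RHS]E; ring.
Qed.

(** Codazzi's equation says that the reflection kills
    [dkap w *: v - dkap v *: w]; as it is injective, taking [v] and [w]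
    independent makes both coefficients vanish. *)
Lemma catenoidal_factor_derive0 v : dkap v = 0.
Proof.
have lin := hf Dx; have [f' _] := lin.
have key a b : dkap b *: a = dkap a *: b.
  apply/eqP; rewrite -subr_eq0; apply/eqP; apply: (reflection_inj Dx).
  have linE : 'D_(dkap b *: a - dkap a *: b) f x =
      dkap b *: 'D_a f x - dkap a *: 'D_b f x.
    by rewrite !deriveE// linearB/= !linearZ.
  pose refl (P : 'rV[R]_3) :=
    (1 - h x ^+ 2) *: P - (2 * dot P k) *: (k - h x *: n x).
  have reflE c d P Q : refl (c *: P - d *: Q) = c *: refl P - d *: refl Q.
    by rewrite /refl dotBl !dotZl; apply/rowP => j; rewrite !mxE; ring.
  apply: etrans (congr1 refl linE) (etrans (reflE _ _ _ _) _).
  apply/eqP; rewrite subr_eq0; apply/eqP; exact: codazzi.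
have e0 : dkap (delta_mx 0 0) = 0.
  have := key (delta_mx 0 1) (delta_mx 0 0) => /rowP/(_ 1).
  by rewrite !mxE /= mulr1 mulr0.
have := key v (delta_mx 0 0); rewrite e0 scale0r => /rowP/(_ 0).
by rewrite !mxE/= mulr1.
Qed.

End constant.

(** The factor is only given pointwise. It is differentiable because it is
    a quotient of the derivatives of the heights of [n] and [f], in a direction
    that is [U] at [x0] and in which [f] still rises nearby. *)
Lemma catenoidal_factor_locally_constant x0 : D x0 ->
  (forall x, D x -> exists kap, catenoidal_at k f n x kap) ->
  exists kap r, 0 < r /\
    forall y, ball x0 r y -> D y /\ catenoidal_at k f n y kap.
Proof.
move=> Dx0 ex; pose kap (x : 'rV[R]_2) : R := xget 0 [set c | catenoidal_at k f n x c].
have law x : D x -> catenoidal_at k f n x (kap x).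
  by move=> /ex[c hc]; apply: (@xgetPex _ 0 [set c | catenoidal_at k f n x c]); exists c.
have hh x (Dx : D x) := has_diff_dotl k (hn Dx).
have s0 x : D x -> 1 - h x ^+ 2 != 0 by move=> Dx; rewrite gt_eqF ?h_lt1.
have [u uE] := U_tangent Dx0.
have Zu0 : Z u x0 != 0.
  by rewrite /Z uE dotBl dotZl k_unit -expr2; exact: s0.
have hD (g : 'rV[R]_2 -> 'rV[R]_3) : smooth_on D g -> C_on 1 D (fun y => 'D_u g y).
  by move=> sg; exact: (sg 2).2.
have hZ x (Dx : D x) := has_diff_dotl k (C_on_has_diff (hD f f_smooth) Dx).
have hN x (Dx : D x) := has_diff_dotl k (C_on_has_diff (hD n n_smooth) Dx).
have : nbhs x0 (D `&` [set y | Z u y != 0]).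
  apply: filterI; first exact: open_nbhs_nbhs (conj oD Dx0).
  have /differentiable_continuous c := (hZ _ Dx0).1.
  exact: cvgr_neq0 c Zu0.
move=> /nbhs_ballP[r /= r0 hr]; exists (kap x0), r; split=> // y xy.
have [Dy _] := hr _ xy; split=> //.
suff <- : kap y = kap x0 by exact: law.
apply: derive0_ball_constant (xy) => {Dy xy}y xy.
have [Dy Zy] := hr _ xy.
have near_kap : \near y, -1 * (dot ('D_u n y) k *
    ((1 - dot (n y) k ^+ 2) * dot ('D_u f y) k)^-1) = kap y.
  have oB : open (ball x0 r) by exact: ball_open.
  have := open_nbhs_nbhs (conj oB xy); apply: filterS => z /hr[Dz Zz].
  rewrite (catenoidal_height _ (law _ Dz)) -/(Z u z) -/(h z).
  by field; rewrite Zz s0.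
have hs := has_diffB (has_diff_cst (1 : R) y) (has_diff_sqr (hh y Dy)).
have nz : (1 - dot (n y) k ^+ 2) * dot ('D_u f y) k != 0.
  by rewrite mulf_neq0//; exact: s0.
have H := has_diff_cstM (-1) (has_diffM (hN y Dy) (has_diffV (has_diffM hs (hZ y Dy)) nz)).
have hkap := near_has_diff near_kap H.
by apply: (has_diff_eq hkap) => v; exact: catenoidal_factor_derive0 Dy law hkap v.
Qed.

Section first_integrals.
Variables (C : R) (x0 : 'rV[R]_2) (r : R).
Hypotheses (C0 : C != 0) (ballD : ball x0 r `<=` D).
Hypothesis law : forall y, ball x0 r y -> catenoidal_at k f n y C.

(** The cosecant of the angle between [k] and the normal. *)
Let csc x := (Num.sqrt (1 - h x ^+ 2))^-1.

Let csc_neq0 x : D x -> csc x != 0.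
Proof. by move=> Dx; rewrite invr_eq0 sqrtr_eq0 -ltNge h_lt1. Qed.

Let cscE x : D x -> 1 - h x ^+ 2 = csc x ^- 2.
Proof. by move=> Dx; rewrite -exprVn invrK sqr_sqrtr// ltW ?h_lt1. Qed.

Let h_derive x v : ball x0 r x -> dot ('D_v n x) k = - C * csc x ^- 2 * Z v x.
Proof.
move=> bx; rewrite (catenoidal_height _ (law bx)) (cscE (ballD bx)).
exact: erefl.
Qed.

Let hh x (Dx : D x) := has_diff_dotl k (hn Dx).

Let hcsc x : ball x0 r x -> has_diff csc x (fun v => - C * h x * csc x * Z v x).
Proof.
move=> bx; have Dx := ballD bx.
have hs := has_diffB (has_diff_cst (1 : R) x) (has_diff_sqr (hh Dx)).
apply: has_diff_eq (has_diff_rsqrt hs (h_lt1 Dx)) _ => v /=.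
rewrite (h_derive _ bx) -/(h x) -/(csc x).
by field; exact: csc_neq0.
Qed.

(** Where the axis is: the horizontal parts of [f] and of [C^-1 n / s^2] have
    the same derivative, so that their difference is constant: it is the point
    where the axis meets the plane orthogonal to [k]. *)
Lemma axis_integral m : dot k m = 0 -> forall y, ball x0 r y ->
  dot (f y) m - C^-1 * (dot (n y) m * csc y ^+ 2) =
  dot (f x0) m - C^-1 * (dot (n x0) m * csc x0 ^+ 2).
Proof.
move=> km; apply: derive0_ball_constant => y by_; have Dy := ballD by_.
have H1 := has_diffM (has_diff_dotl m (hn Dy)) (has_diff_sqr (hcsc by_)).
have H := has_diffB (has_diff_dotl m (hf Dy)) (has_diff_cstM C^-1 H1).
apply: has_diff_eq H _ => v.
have -> : dot ('D_v n y) m = C * (csc y ^- 2 * dot ('D_v f y) m +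
    2 * Z v y * h y * dot (n y) m).
  rewrite (law by_) -/(h y) -/(Z v y) (cscE Dy) dotZl dotBl !dotZl dotBl dotZl km.
  by rewrite sub0r mulrN opprK mulrA.
move: (csc_neq0 Dy) (dot ('D_v f y) m) (dot (n y) m) (Z v y) => cs0 p q z.
move: (h y) (csc y) cs0 => hy cy cs0.
by field; rewrite cs0 C0.
Qed.

(** The arc length of the profile curve, counted from the waist. *)
Let arc y := - (C^-1 * (h y * csc y)).

Lemma arc_sqr y : D y -> arc y ^+ 2 + `|C|^-1 ^+ 2 = (`|C|^-1 * csc y) ^+ 2.
Proof.
move=> Dy; have c0 := csc_neq0 Dy.
have e : `|C|^-1 ^+ 2 = C^-1 ^+ 2 by rewrite -normfV real_normK ?num_real.
rewrite exprMn e /arc; have := cscE Dy.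
move: (h y) (csc y) c0 => hy cy cy0 E.
have {}E : hy ^+ 2 = 1 - cy ^- 2 by rewrite -E opprB addrC subrK.
rewrite sqrrN !exprMn E; field.
by rewrite C0 cy0.
Qed.

Lemma arc_sqrt y : D y -> Num.sqrt (arc y ^+ 2 + `|C|^-1 ^+ 2) = `|C|^-1 * csc y.
Proof.
move=> Dy; rewrite arc_sqr// sqrtr_sqr ger0_norm// mulr_ge0// invr_ge0//.
Qed.

Lemma has_diff_arc y : ball x0 r y -> has_diff arc y (fun v => csc y * Z v y).
Proof.
move=> by_; have Dy := ballD by_.
have H := has_diff_cstM (- C^-1) (has_diffM (hh Dy) (hcsc by_)).
have -> : arc = (fun z => - C^-1 * (h z * csc z)).
  by apply/funext => z; rewrite mulNr.
apply: has_diff_eq H _ => v /=.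
rewrite (h_derive _ by_) -/(h y).
have c0 := csc_neq0 Dy; have := cscE Dy.
move: (h y) (csc y) c0 (Z v y) => hy cy cy0 z E.
have {}E : hy ^+ 2 = 1 - cy ^- 2 by rewrite -E opprB addrC subrK.
rewrite (_ : _ + _ = - (C * z) * (cy^-1 + hy ^+ 2 * cy)); last by field.
by rewrite E; field; rewrite C0 cy0.
Qed.

(** The height and [c asinh (arc / c)], where [c = 1 / |C|], have the same
    derivative. *)
Lemma height_integral y : ball x0 r y ->
  dot (f y) k - `|C|^-1 * ln (arc y + Num.sqrt (arc y ^+ 2 + `|C|^-1 ^+ 2)) =
  dot (f x0) k - `|C|^-1 * ln (arc x0 + Num.sqrt (arc x0 ^+ 2 + `|C|^-1 ^+ 2)).
Proof.
move: y; apply: derive0_ball_constant => y by_; have Dy := ballD by_.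
have c0 : `|C|^-1 != 0 by rewrite invr_eq0 normr_eq0.
have H := has_diffB (has_diff_dotl k (hf Dy))
  (has_diff_cstM `|C|^-1 (has_diff_asinh c0 (has_diff_arc by_))).
apply: has_diff_eq H _ => v /=.
rewrite arc_sqrt// -/(Z v y).
have := csc_neq0 Dy; move: (csc y) (Z v y) => cy z cy0.
by field; rewrite cy0 normr_eq0 C0.
Qed.

End first_integrals.
End local_surface.

(** * Frames and the catenoid *)

Section coordinates.
Context (R : realType).

Lemma ord2P (i : 'I_2) : i = 0 \/ i = 1.
Proof. by case: i => [[|[|//]] hi]; [left|right]; apply/val_inj. Qed.

Lemma ord3P (i : 'I_3) : [\/ i = 0, i = 1 | i = 2%:R].
Proof.
by case: i => [[|[|[|//]]] hi];
  [constructor 1|constructor 2|constructor 3]; apply/val_inj.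
Qed.

Lemma vec2E (x y : R) : vec2 x y 0 0 = x /\ vec2 x y 0 1 = y.
Proof. by rewrite !mxE. Qed.

Lemma vec3E (x y z : R) :
  [/\ vec3 x y z 0 0 = x, vec3 x y z 0 1 = y & vec3 x y z 0 2%:R = z].
Proof. by rewrite !mxE. Qed.

Lemma vec2_eta (u : 'rV[R]_2) : vec2 (u 0 0) (u 0 1) = u.
Proof. by apply/rowP => i; case: (ord2P i) => ->; rewrite !mxE. Qed.

Lemma dot3E (u v : 'rV[R]_3) :
  dot u v = u 0 0 * v 0 0 + u 0 1 * v 0 1 + u 0 2%:R * v 0 2%:R.
Proof.
rewrite dotE !big_ord_recl big_ord0 addr0 addrA.
by congr (_ + _ * _ + _ * _); congr (_ 0 _); apply/val_inj.
Qed.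

Lemma C_on_vec2 (V : normedModType R) n (D : set V) (a b : V -> R) : open D ->
  C_on n D a -> C_on n D b -> C_on n D (fun x => vec2 (a x) (b x)).
Proof.
move=> oD ha hb; apply: C_on_row => // j.
case: (ord2P j) => ->; [have -> : (fun x => vec2 (a x) (b x) 0 0) = a|
  have -> : (fun x => vec2 (a x) (b x) 0 1) = b] => //;
by apply/funext => x; rewrite mxE.
Qed.

Lemma has_diff_vec3 (V : normedModType R) (a b d : V -> R) x da db dd :
  has_diff a x da -> has_diff b x db -> has_diff d x dd ->
  has_diff (fun y => vec3 (a y) (b y) (d y)) x
    (fun v => vec3 (da v) (db v) (dd v)).
Proof.
move=> ha hb hd; apply: has_diff_row => j.
have E (p q r : V -> R) : [/\ (fun x => vec3 (p x) (q x) (r x) 0 0) = p,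
   (fun x => vec3 (p x) (q x) (r x) 0 1) = q &
   (fun x => vec3 (p x) (q x) (r x) 0 2%:R) = r].
  by split; apply/funext => y; rewrite mxE.
have [E1 E2 E3] := E a b d; have [F1 F2 F3] := E da db dd.
by case: (ord3P j) => ->; rewrite ?E1 ?E2 ?E3 ?F1 ?F2 ?F3.
Qed.

Lemma has_diff_catenoid (c : R) (z : 'rV[R]_2) : c != 0 ->
  let s := Num.sqrt (z 0 0 ^+ 2 + c ^+ 2) in
  has_diff (fun z : 'rV[R]_2 => catenoid c (z 0 0) (z 0 1)) z
    (fun v => vec3
      (z 0 0 / s * v 0 0 * cos (z 0 1) - s * sin (z 0 1) * v 0 1)
      (z 0 0 / s * v 0 0 * sin (z 0 1) + s * cos (z 0 1) * v 0 1)
      (c / s * v 0 0)).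
Proof.
move=> c0 s.
have q0 : 0 < z 0 0 ^+ 2 + c ^+ 2.
  by rewrite ltr_wpDl ?sqr_ge0// exprn_even_gt0.
have s0 : s != 0 by rewrite sqrtr_eq0 -ltNge.
have hx : has_diff (fun z : 'rV[R]_2 => z 0 0) z (fun v => v 0 0).
  exact: has_diff_coord (has_diff_id z).
have hy : has_diff (fun z : 'rV[R]_2 => z 0 1) z (fun v => v 0 1).
  exact: has_diff_coord (has_diff_id z).
have hq := has_diffD (has_diff_sqr hx) (has_diff_cst (c ^+ 2) z).
have hs := has_diff_comp1 hq (is_derive1_sqrt q0).
have h1 := has_diffM hs (has_diff_comp1 hy (is_derive_cos _)).
have h2 := has_diffM hs (has_diff_comp1 hy (is_derive_sin _)).
have h3 := has_diff_cstM c (has_diff_asinh c0 hx).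
apply: has_diff_eq (has_diff_vec3 h1 h2 h3) _ => v.
by rewrite /= -/s; congr vec3; field.
Qed.

(** The cross product of [k] and [m] will do. *)
Lemma orthonormal_completion (k m : 'rV[R]_3) :
  dot k k = 1 -> dot m m = 1 -> dot k m = 0 ->
  exists w, [/\ dot w w = 1, dot w k = 0 & dot w m = 0].
Proof.
move=> kk mm km.
exists (vec3 (k 0 1 * m 0 2%:R - k 0 2%:R * m 0 1)
  (k 0 2%:R * m 0 0 - k 0 0 * m 0 2%:R) (k 0 0 * m 0 1 - k 0 1 * m 0 0)).
move: kk mm km; rewrite !dot3E.
set w := vec3 _ _ _; have [-> -> ->] := vec3E (k 0 1 * m 0 2%:R - k 0 2%:R * m 0 1)
  (k 0 2%:R * m 0 0 - k 0 0 * m 0 2%:R) (k 0 0 * m 0 1 - k 0 1 * m 0 0).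
move: (k 0 0) (k 0 1) (k 0 2%:R) (m 0 0) (m 0 1) (m 0 2%:R).
move=> a b d x y z kk mm km; split; try by ring.
transitivity ((a * a + b * b + d * d) * (x * x + y * y + z * z) -
  (a * x + b * y + d * z) ^+ 2); first by ring.
by rewrite kk mm km; ring.
Qed.

(** Columns rather than rows because vectors are rows: right multiplication
    then reads off the coordinates in an orthonormal frame. *)
Definition frame (m w k : 'rV[R]_3) : 'M[R]_3 :=
  (\matrix_(i < 3) [:: m; w; k]`_i)^T.

Lemma frameE m w k u :
  u *m frame m w k = vec3 (dot u m) (dot u w) (dot u k).
Proof.
apply/rowP => j; rewrite !mxE.
by case: (ord3P j) => ->; rewrite /= dotE; apply: eq_bigr => i _; rewrite !mxE.
Qed.

Section orthonormal.
Variables (m w k : 'rV[R]_3).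
Hypotheses (mm : dot m m = 1) (ww : dot w w = 1) (kk : dot k k = 1).
Hypotheses (wk : dot w k = 0) (wm : dot w m = 0) (km : dot k m = 0).
Local Notation Q := (frame m w k).

Lemma frame_orthogonal : Q *m Q^T = 1%:M.
Proof.
apply: mulmx1C; apply/row_matrixP => i.
have rowQ : row i Q^T = [:: m; w; k]`_i by rewrite /frame trmxK rowK.
rewrite row_mul rowQ frameE; apply/rowP => j; rewrite !mxE.
case: (ord3P i) => ->; case: (ord3P j) => ->;
  rewrite /= ?mm ?ww ?kk ?wk ?wm ?km ?(dotC m) ?(dotC k w) ?wk ?wm ?km.
all: reflexivity.
Qed.

Lemma dot_frame u v : dot (u *m Q) (v *m Q) = dot u v.
Proof. by rewrite /dot trmx_mul mulmxA -(mulmxA u) frame_orthogonal mulmx1. Qed.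

Lemma frame_isometry t : ambient_isometry (fun u => u *m Q + t).
Proof.
move=> u v; rewrite /enorm opprD addrACA subrr addr0 -mulmxBl.
by rewrite dot_frame.
Qed.

Lemma frame_carries t : carries_direction (fun u => u *m Q + t) k (vec3 0 0 1).
Proof.
move=> v; rewrite opprD addrACA subrr addr0 -mulmxBl addrAC subrr add0r.
by rewrite frameE km kk dotC wk.
Qed.

Lemma frame_inj (u v : 'rV[R]_3) : u *m Q = v *m Q -> u = v.
Proof.
by move=> e; rewrite -[u]mulmx1 -[v]mulmx1 -frame_orthogonal !mulmxA e.
Qed.

End orthonormal.

Lemma sin_atan (x : R) : sin (atan x) = x / Num.sqrt (1 + x ^+ 2).
Proof.
have c0 : cos (atan x) != 0.
  by rewrite cos_atan invr_eq0 sqrtr_eq0 -ltNge ltr_pwDl// sqr_ge0.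
by rewrite -cos_atan -{2}(atanK x) /tan divfK.
Qed.

(** The polar angle of the point [(a, b)] of the right half-plane. *)
Lemma atan_polar (a b d : R) : 0 < a -> 0 < d -> a ^+ 2 + b ^+ 2 = d ^+ 2 ->
  cos (atan (b / a)) = a / d /\ sin (atan (b / a)) = b / d.
Proof.
move=> a0 d0 abd.
have e : Num.sqrt (1 + (b / a) ^+ 2) = d / a.
  rewrite (_ : 1 + _ = (d / a) ^+ 2); first by rewrite sqrtr_sqr ger0_norm// ltW// divr_gt0.
  by rewrite !exprMn -abd; field; rewrite gt_eqF.
by rewrite cos_atan sin_atan e; split; field; rewrite !gt_eqF.
Qed.

End coordinates.

(** * Catenoid coordinates *)

Section catenoid_coordinates.
Context (R : realType) (k : 'rV[R]_3) (f n : 'rV[R]_2 -> 'rV[R]_3).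
Variable D : set 'rV[R]_2.
Hypotheses (k_unit : dot k k = 1) (oD : open D).
Hypotheses (f_smooth : smooth_on D f) (n_smooth : smooth_on D n).
Hypothesis f_immersion : forall x v, D x -> 'D_v f x = 0 -> v = 0.
Hypothesis n_unit : forall x, dot (n x) (n x) = 1.
Let h x := dot (n x) k.
Hypothesis h_lt1 : forall x, D x -> 0 < 1 - h x ^+ 2.
Variables (C : R) (x0 : 'rV[R]_2) (r : R).
Hypotheses (C0 : C != 0) (r0 : 0 < r) (ballD : ball x0 r `<=` D).
Hypothesis law : forall y, ball x0 r y -> catenoidal_at k f n y C.

(** In a frame of the ambient space adapted to the normal at [x0], the first
    integrals determine [f] from the arc length of the profile and the angle of
    the horizontal part of the normal, by the formula of the catenoid. These two
    functions are coordinates by [local_inverse]: as [f] factors through them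
    and is an immersion, so is the pair. *)
Lemma catenoid_coordinates :
  exists (c : R) (G : 'rV[R]_3 -> 'rV[R]_3) (W : set 'rV[R]_2)
    (Phi Psi : 'rV[R]_2 -> 'rV[R]_2),
  [/\ [/\ c != 0, ambient_isometry G & carries_direction G k (vec3 0 0 1)],
      [/\ open W, W x0, W `<=` D & open (Phi @` W)],
      smooth_on W Phi /\ smooth_on (Phi @` W) Psi,
      forall x, W x -> Psi (Phi x) = x &
      forall x, W x -> G (f x) = catenoid c (Phi x 0 0) (Phi x 0 1)].
Proof.
pose csc x := (Num.sqrt (1 - h x ^+ 2))^-1.
have bx0 : ball x0 r x0 by exact: ballxx.
have Dx0 := ballD bx0.
have csc_gt0 x : D x -> 0 < csc x by move=> Dx; rewrite invr_gt0 sqrtr_gt0 h_lt1.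
have cscE x : D x -> 1 - h x ^+ 2 = csc x ^- 2.
  by move=> Dx; rewrite -exprVn invrK sqr_sqrtr// ltW// h_lt1.
(* The normal points away from the axis if [C] is positive and towards it
   otherwise. *)
pose eps := Num.sg C.
have eps2 : eps * eps = 1.
  by rewrite /eps -expr2 sqr_sg C0.
have epsC : eps * C^-1 = `|C|^-1.
  rewrite /eps; case: (ltrgt0P C) C0 => // C1 _.
    by rewrite gtr0_sg// mul1r.
  by rewrite ltr0_sg// mulN1r invrN.
(* The outward radial direction at the base point, the direction of
   increasing polar angle there, and [k] make up the frame. *)
pose m := (eps * csc x0) *: (n x0 - h x0 *: k).
have km : dot k m = 0.
  by rewrite /m dotZr dotBr dotZr k_unit mulr1 dotC -/(h x0) subrr mulr0.
have mm : dot m m = 1.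
  rewrite /m dotZl dotZr dotBl !dotBr !dotZl !dotZr k_unit n_unit (dotC k) -/(h x0).
  rewrite mulrA mulrACA eps2 mul1r.
  rewrite (_ : 1 - _ - _ = 1 - h x0 ^+ 2); last by ring.
  by rewrite (cscE _ Dx0) -expr2 divff// expf_neq0// gt_eqF// csc_gt0.
have [w [ww wk wm]] := orthonormal_completion k_unit mm km.
pose Q := frame m w k.
pose a y := eps * dot (n y) m.
pose b y := eps * dot (n y) w.
pose arc y := - (C^-1 * (h y * csc y)).
pose Phi y := vec2 (arc y) (atan (b y / a y)).
have ab y : D y -> a y ^+ 2 + b y ^+ 2 = (csc y)^-1 ^+ 2.
  move=> Dy; rewrite exprVn -cscE//.
  have := dot_frame mm ww k_unit wk wm km (n y) (n y).
  rewrite n_unit !frameE dot3E.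
  have [-> -> ->] := vec3E (dot (n y) m) (dot (n y) w) (dot (n y) k).
  rewrite -/(h y) => E; rewrite /a /b !exprMn [eps ^+ 2]expr2 eps2 !mul1r.
  by rewrite -E; ring.
have a0 : 0 < a x0.
  rewrite /a /m dotZr dotBr dotZr n_unit -/(h x0) mulrA mulrA eps2 mul1r.
  by rewrite -expr2 mulr_gt0// ?csc_gt0// h_lt1.
pose B := [set y | ball x0 r y /\ 0 < a y].
have smooth_dot u i : C_on i D (fun y => dot (n y) u).
  under eq_fun do rewrite dotE.
  apply: C_on_sum => // j; apply: C_onM => //; last exact: C_on_cst.
  exact: C_on_coord oD (n_smooth i).
have smooth_a i : C_on i D a.
  exact: C_onM oD (C_on_cst _ _ _) (smooth_dot _ _).
have smooth_b i : C_on i D b.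
  exact: C_onM oD (C_on_cst _ _ _) (smooth_dot _ _).
have oB : open B.
  rewrite openE => y [by_ ay]; apply: filterI.
    by apply: open_nbhs_nbhs; split; [exact: ball_open|exact: by_].
  exact: cvgr_gt ((smooth_a 0%N) y (ballD by_)) _ ay.
have BD : B `<=` D by move=> y [/ballD].
have smooth_s i : C_on i D (fun y => 1 - h y ^+ 2).
  apply: C_onD => //; first exact: C_on_cst.
  apply: C_onN => //; under eq_fun do rewrite expr2.
  by apply: C_onM => //; exact: smooth_dot.
have smooth_arc i : C_on i D arc.
  apply: C_onN => //; apply: C_onM => //; first exact: C_on_cst.
  apply: C_onM => //; first exact: smooth_dot.
  exact: C_on_rsqrt.
have smooth_Phi : smooth_on B Phi.
  move=> i; apply: C_on_vec2 => //; first exact: C_on_sub BD (smooth_arc i).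
  apply: C_on_atan => //; apply: C_onM => //; first exact: C_on_sub BD (smooth_b i).
  apply: C_onV => //; last exact: C_on_sub BD (smooth_a i).
  by move=> y [_ ay]; rewrite gt_eqF.
pose c := `|C|^-1.
have c0 : c != 0 by rewrite invr_eq0 normr_eq0.
pose P y := catenoid c (Phi y 0 0) (Phi y 0 1).
pose t := P x0 - f x0 *m Q.
pose G (u : 'rV[R]_3) := u *m Q + t.
have Pcoord y : B y -> P y = vec3 (C^-1 * (dot (n y) m * csc y ^+ 2))
    (C^-1 * (dot (n y) w * csc y ^+ 2))
    (c * ln (arc y + Num.sqrt (arc y ^+ 2 + c ^+ 2))).
  move=> [by_ ay]; have Dy := ballD by_.
  rewrite /P /catenoid; have [-> ->] := vec2E (arc y) (atan (b y / a y)).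
  have d0 : 0 < (csc y)^-1 by rewrite invr_gt0 csc_gt0.
  have [-> ->] := atan_polar ay d0 (ab y Dy).
  have cy0 : csc y != 0 by rewrite gt_eqF// csc_gt0.
  have es : Num.sqrt (arc y ^+ 2 + c ^+ 2) = c * csc y.
    exact: (arc_sqrt h_lt1 C0 Dy).
  have cE : c = eps * C^-1 by rewrite epsC.
  rewrite es invrK /a /b; congr vec3; rewrite cE.
    transitivity (eps * eps * (C^-1 * (dot (n y) m * csc y ^+ 2))); first by ring.
    by rewrite eps2 mul1r.
  transitivity (eps * eps * (C^-1 * (dot (n y) w * csc y ^+ 2))); first by ring.
  by rewrite eps2 mul1r.
have Bx0 : B x0 by [].
have GP y : B y -> G (f y) = P y.
  move=> By; have [by_ ay] := By.
  have A u : dot k u = 0 -> dot (f y) u - C^-1 * (dot (n y) u * csc y ^+ 2) =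
      dot (f x0) u - C^-1 * (dot (n x0) u * csc x0 ^+ 2).
    by move=> ku; apply: (axis_integral k_unit f_smooth n_smooth h_lt1 C0 ballD law ku).
  have H : dot (f y) k - c * ln (arc y + Num.sqrt (arc y ^+ 2 + c ^+ 2)) =
      dot (f x0) k - c * ln (arc x0 + Num.sqrt (arc x0 ^+ 2 + c ^+ 2)).
    exact: (height_integral k_unit f_smooth n_smooth h_lt1 C0 ballD law).
  have kw : dot k w = 0 by rewrite dotC.
  rewrite /G /t !frameE (Pcoord y By) (Pcoord x0 Bx0).
  move: (A m km) (A w kw) H.
  set p1 := C^-1 * _; set q1 := C^-1 * _; set p2 := C^-1 * _; set q2 := C^-1 * _.
  set p3 := c * _; set q3 := c * _.
  move=> E1 E2 E3; apply/rowP => j; rewrite !mxE.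
  case: (ord3P j) => -> /=.
  - by move: E1; lra.
  - by move: E2; lra.
  - by move: E3; lra.
have Phi_inj v : 'D_v Phi x0 = 0 -> v = 0.
  move=> Pv; apply: (f_immersion Dx0).
  have hPhi := C_on_has_diff (smooth_Phi 1%N) Bx0.
  have hP := has_diff_comp hPhi (has_diff_catenoid (Phi x0) c0).
  have hfQ := has_diff_comp (C_on_has_diff (f_smooth 1%N) Dx0) (has_diff_mulmxr Q (f x0)).
  have hG := has_diffD hfQ (has_diff_cst t x0).
  have E : \near x0, f x0 *m Q + t = catenoid c (Phi x0 0 0) (Phi x0 0 1).
    by have := open_nbhs_nbhs (conj oB Bx0); apply: filterS => y /GP.
  have [_ /(_ v)] := near_has_diff E hG.
  rewrite hP.2 Pv addr0 !mxE !mulr0 !mul0r subrr addr0 => E0.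
  apply: (frame_inj mm ww k_unit wk wm km); rewrite mul0mx -/Q.
  apply: etrans (esym E0) _.
  by apply/rowP => j; rewrite mxE; case: (ord3P j) => ->; rewrite mxE.
have [W [Psi [oW [Wx0 WB] oPW K sPsi]]] := local_inverse oB Bx0 smooth_Phi Phi_inj.
exists c, G, W, Phi, Psi; split.
- split=> //; first exact: frame_isometry.
  exact: frame_carries.
- by split=> // y /WB/BD.
- by split=> // i; exact: C_on_sub WB (smooth_Phi i).
- exact: K.
- by move=> y /WB/GP.
Qed.

End catenoid_coordinates.

(** * The shape operator of a catenoid *)

Section isometries.
Context (R : realType).

(** Once translated to fix the origin, [G] preserves scalar products by
    polarization, so it maps the standard basis to an orthonormal one and a
    vector is recovered from its coordinates there. *)
Lemma ambient_isometry_affine (G : 'rV[R]_3 -> 'rV[R]_3) : ambient_isometry G ->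
  exists2 Q, Q *m Q^T = 1%:M & exists t, forall u, G u = u *m Q + t.
Proof.
move=> iG; have [g gE] : exists g, forall u, g u = G u - G 0.
  by exists (fun u => G u - G 0).
have dotG u v : dot (G u - G v) (G u - G v) = dot (u - v) (u - v).
  have := iG u v; rewrite /enorm => /(congr1 (fun t => t ^+ 2)).
  by rewrite !sqr_sqrtr ?dot_ge0.
have g2 u : dot (g u) (g u) = dot u u by rewrite gE dotG subr0.
have gdot u v : dot (g u) (g v) = dot u v.
  have := dotG u v; have -> : G u - G v = g u - g v.
    by rewrite !gE opprB addrA subrK.
  rewrite !dotBl !dotBr !g2 (dotC (g v)) (dotC v); lra.
pose Q : 'M[R]_3 := \matrix_(i < 3) g (delta_mx 0 i).
have gQ u : g u *m Q^T = u.
  apply/rowP => j.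
  have -> : (g u *m Q^T) 0 j = dot (g u) (g (delta_mx 0 j)).
    by rewrite dotE mxE; apply: eq_bigr => i _; rewrite !mxE.
  by rewrite gdot /dot trmx_delta -colE mxE.
have QQ : Q *m Q^T = 1%:M.
  apply/row_matrixP => i; rewrite row_mul rowK gQ.
  by rewrite rowE mulmx1.
exists Q => //; exists (G 0) => u.
by rewrite -{2}(gQ u) -mulmxA (mulmx1C QQ) mulmx1 gE subrK.
Qed.

End isometries.

Section catenoid_normal.
Context (R : realType) (c : R).
Hypothesis c0 : c != 0.
Let s (z : 'rV[R]_2) := Num.sqrt (z 0 0 ^+ 2 + c ^+ 2).

Definition catenoid_normal (z : 'rV[R]_2) : 'rV[R]_3 :=
  vec3 (c * ((s z)^-1 * cos (z 0 1))) (c * ((s z)^-1 * sin (z 0 1)))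
    (- (z 0 0 * (s z)^-1)).

Let cat (z : 'rV[R]_2) := catenoid c (z 0 0) (z 0 1).

Let q_gt0 z : 0 < (z : 'rV[R]_2) 0 0 ^+ 2 + c ^+ 2.
Proof. by rewrite ltr_wpDl ?sqr_ge0// exprn_even_gt0. Qed.

Let s_neq0 z : s z != 0.
Proof. by rewrite sqrtr_eq0 -ltNge. Qed.

Let s_sqr z : s z ^+ 2 = z 0 0 ^+ 2 + c ^+ 2.
Proof. by rewrite sqr_sqrtr// ltW. Qed.

Let has_diff_normal z : has_diff catenoid_normal z (fun v => vec3
  (- c * (z 0 0 / s z ^+ 3 * v 0 0 * cos (z 0 1) + (s z)^-1 * sin (z 0 1) * v 0 1))
  (- c * (z 0 0 / s z ^+ 3 * v 0 0 * sin (z 0 1) - (s z)^-1 * cos (z 0 1) * v 0 1))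
  (- (c ^+ 2 / s z ^+ 3 * v 0 0))).
Proof.
have hx : has_diff (fun z : 'rV[R]_2 => z 0 0) z (fun v => v 0 0).
  exact: has_diff_coord (has_diff_id z).
have hy : has_diff (fun z : 'rV[R]_2 => z 0 1) z (fun v => v 0 1).
  exact: has_diff_coord (has_diff_id z).
have hq := has_diffD (has_diff_sqr hx) (has_diff_cst (c ^+ 2) z).
have hs := has_diff_rsqrt hq (q_gt0 z).
have h1 := has_diff_cstM c (has_diffM hs (has_diff_comp1 hy (is_derive_cos _))).
have h2 := has_diff_cstM c (has_diffM hs (has_diff_comp1 hy (is_derive_sin _))).
have h3 := has_diff_cstM (-1) (has_diffM hx hs).
have E : catenoid_normal = fun z => vec3 (c * ((s z)^-1 * cos (z 0 1)))
    (c * ((s z)^-1 * sin (z 0 1))) (- 1 * (z 0 0 * (s z)^-1)).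
  by apply/funext => y; rewrite mulN1r.
rewrite E; apply: has_diff_eq (has_diff_vec3 h1 h2 h3) _ => v /=.
rewrite -/(s z); have := s_sqr z; have := s_neq0 z.
move: (s z) (z 0 0) (z 0 1) (v 0 0) (v 0 1) => S x y a b S0 S2.
congr vec3; [by field|by field|].
rewrite (_ : c ^+ 2 = S ^+ 2 - x ^+ 2); last by rewrite S2 addrAC subrr add0r.
by field.
Qed.

Let h_normal z : catenoid_normal z 0 2%:R = - (z 0 0 / s z).
Proof. by rewrite mxE. Qed.

Lemma catenoid_normal_unit z : dot (catenoid_normal z) (catenoid_normal z) = 1.
Proof.
rewrite dot3E; have [-> -> ->] := vec3E (c * ((s z)^-1 * cos (z 0 1)))
  (c * ((s z)^-1 * sin (z 0 1))) (- (z 0 0 * (s z)^-1)).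
have E := cos2Dsin2 (z 0 1); have S2 := s_sqr z; have S0 := s_neq0 z.
transitivity ((c ^+ 2 * (cos (z 0 1) ^+ 2 + sin (z 0 1) ^+ 2) + z 0 0 ^+ 2) / s z ^+ 2).
  by move: (s z) S0 => S S0; field.
by rewrite E mulr1 addrC -S2 divff// expf_neq0.
Qed.

(** The two coordinate directions leave a single normal line. *)
Lemma catenoid_normal_unique z (p : 'rV[R]_3) :
  (forall v, dot ('D_v cat z) p = 0) ->
  p = dot p (catenoid_normal z) *: catenoid_normal z.
Proof.
move=> orth; have hc := has_diff_catenoid z c0.
have e0 : z 0 0 * (cos (z 0 1) * p 0 0 + sin (z 0 1) * p 0 1) + c * p 0 2%:R = 0.
  have := orth (delta_mx 0 0); rewrite /cat hc.2 dot3E !mxE /= -/(s z).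
  move/(congr1 ( *%R (s z))); rewrite [X in _ = X]mulr0 => H; rewrite -[RHS]H.
  by field; exact: s_neq0.
have e1 : cos (z 0 1) * p 0 1 = sin (z 0 1) * p 0 0.
  have := orth (delta_mx 0 1); rewrite /cat hc.2 dot3E !mxE /= -/(s z).
  move/(congr1 ( *%R (s z)^-1)); rewrite [X in _ = X]mulr0 => H.
  apply/eqP; rewrite -subr_eq0 -[X in _ == X]H; apply/eqP.
  by field; exact: s_neq0.
pose T := cos (z 0 1) * p 0 0 + sin (z 0 1) * p 0 1.
have E := cos2Dsin2 (z 0 1).
have p0E : p 0 0 = T * cos (z 0 1).
  transitivity (p 0 0 * (cos (z 0 1) ^+ 2 + sin (z 0 1) ^+ 2) +
    sin (z 0 1) * (cos (z 0 1) * p 0 1 - sin (z 0 1) * p 0 0)).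
    by rewrite E e1; ring.
  by rewrite /T; ring.
have p1E : p 0 1 = T * sin (z 0 1).
  transitivity (p 0 1 * (cos (z 0 1) ^+ 2 + sin (z 0 1) ^+ 2) -
    cos (z 0 1) * (cos (z 0 1) * p 0 1 - sin (z 0 1) * p 0 0)).
    by rewrite E e1; ring.
  by rewrite /T; ring.
have S0 := s_neq0 z; have S2 := s_sqr z.
have dE : dot p (catenoid_normal z) = (c * T - z 0 0 * p 0 2%:R) / s z.
  by rewrite dot3E /T !mxE /= -/(s z); field.
have p2E : p 0 2%:R = - (z 0 0 * T) / c.
  apply: (mulfI c0); rewrite mulrCA divff// mulr1.
  by apply/eqP; rewrite -addr_eq0 addrC e0.
have dE' : dot p (catenoid_normal z) = T * s z / c.
  rewrite dE p2E.
  transitivity (T * (z 0 0 ^+ 2 + c ^+ 2) / (s z * c)); first by field; rewrite S0 c0.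
  by rewrite -S2; field; rewrite S0 c0.
apply/rowP => j; rewrite [RHS]mxE dE'.
case: (ord3P j) => ->; rewrite !mxE /= -/(s z).
- by rewrite p0E; field; rewrite S0 c0.
- by rewrite p1E; field; rewrite S0 c0.
- by rewrite p2E; field; rewrite S0 c0.
Qed.

Lemma catenoid_normal_catenoidal z :
  catenoidal_at (vec3 0 0 1) cat catenoid_normal z c^-1.
Proof.
move=> v; rewrite (has_diff_normal z).2 /cat (has_diff_catenoid z c0).2 -/(s z).
have hE (p : 'rV[R]_3) : dot p (vec3 0 0 1) = p 0 2%:R.
  by rewrite dot3E !mxE /= !mulr0 !add0r mulr1.
rewrite !hE h_normal.
have S0 := s_neq0 z; have S2 := s_sqr z.
have hs : 1 - (- (z 0 0 / s z)) ^+ 2 = c ^+ 2 / s z ^+ 2.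
  rewrite sqrrN (_ : c ^+ 2 = s z ^+ 2 - z 0 0 ^+ 2); last first.
    by rewrite S2 addrAC subrr add0r.
  by field.
rewrite hs; apply/rowP => j; rewrite [RHS]mxE.
case: (ord3P j) => ->; rewrite !mxE /= -/(s z).
- by field; rewrite S0 c0.
- by field; rewrite S0 c0.
- have -> : 1 - - (z 0 0 / s z) * - (z 0 0 / s z) = c ^+ 2 / s z ^+ 2.
    by rewrite -hs; ring.
  by field; rewrite S0 c0.
Qed.

Section normal_field.
Variables (k : 'rV[R]_3) (f n : 'rV[R]_2 -> 'rV[R]_3).
Variables (G : 'rV[R]_3 -> 'rV[R]_3) (O : set 'rV[R]_2) (x : 'rV[R]_2).
Hypotheses (iG : ambient_isometry G) (kG : carries_direction G k (vec3 0 0 1)).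
Hypotheses (oO : open O) (Ox : O x).
Hypothesis Gf : forall y, O y -> G (f y) = cat y.
Hypothesis n_unit : forall y, dot (n y) (n y) = 1.
Hypothesis n_ortho : forall y v, O y -> dot ('D_v f y) (n y) = 0.
Hypothesis n_diff : differentiable n x.
Hypothesis f_diff : forall y, O y -> differentiable f y.

(** Up to the isometry, [n] is [eps] times [catenoid_normal]. The sign [eps]
    is a scalar product, hence differentiable, and its square is 1, so that its
    derivative vanishes; the property then passes from [catenoid_normal] to [n],
    with [kappa] multiplied by [eps]. *)
Lemma catenoid_catenoidal_at : exists kap, catenoidal_at k f n x kap.
Proof.
have [Q QQ [t GE]] := ambient_isometry_affine iG.
have kQ : k *m Q = vec3 0 0 1.
  by have := kG 0; rewrite !GE add0r mul0mx add0r addrK.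
have dotQ (u v : 'rV[R]_3) : dot (u *m Q) (v *m Q) = dot u v.
  by rewrite /dot trmx_mul mulmxA -(mulmxA u) QQ mulmx1.
have injQ (u v : 'rV[R]_3) : u *m Q = v *m Q -> u = v.
  by move=> e; rewrite -[u]mulmx1 -[v]mulmx1 -QQ !mulmxA e.
have fQ y v : O y -> 'D_v f y *m Q = 'D_v cat y.
  move=> Oy; have E : \near y, f y *m Q + t = cat y.
    have := open_nbhs_nbhs (conj oO Oy).
    by apply: filterS => z Oz; rewrite -Gf// GE.
  have hf := has_diff_comp (has_diffP (f_diff Oy)) (has_diff_mulmxr Q (f y)).
  have H := near_has_diff E (has_diffD hf (has_diff_cst t y)).
  by rewrite H.2 addr0.
pose nQ y := n y *m Q.
pose eps y := dot (nQ y) (catenoid_normal y).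
have nE y : O y -> nQ y = eps y *: catenoid_normal y.
  move=> Oy; apply: catenoid_normal_unique => v.
  apply: etrans (congr1 (fun u => dot u (nQ y)) (esym (fQ y v Oy))) _.
  by rewrite dotQ n_ortho.
have eps2 y : O y -> eps y ^+ 2 = 1.
  move=> Oy; have : dot (nQ y) (nQ y) = 1 by rewrite dotQ.
  by rewrite (nE y Oy) dotZl dotZr catenoid_normal_unit mulr1 expr2.
have hnQ : has_diff nQ x (fun v => 'D_v n x *m Q).
  exact: has_diff_comp (has_diffP n_diff) (has_diff_mulmxr Q (n x)).
have heps := has_diff_dot hnQ (has_diff_normal x).
have eps0 : eps x != 0.
  by apply/eqP => e; have := eps2 x Ox; rewrite e expr0n => /esym/eqP; rewrite oner_eq0.
have deps v : 'D_v eps x = 0.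
  have E : \near x, 1 = eps x ^+ 2.
    by have := open_nbhs_nbhs (conj oO Ox); apply: filterS => y /eps2.
  have [_ /(_ v)] := near_has_diff E (has_diff_cst (1 : R) x).
  rewrite (has_diff_sqr (has_diffP heps.1)).2 => /eqP.
  by rewrite !mulf_eq0 (negbTE eps0) pnatr_eq0 => /eqP.
have dnQ v : 'D_v n x *m Q = eps x *: 'D_v catenoid_normal x.
  apply/rowP => j.
  have E : \near x, eps x * catenoid_normal x 0 j = nQ x 0 j.
    have := open_nbhs_nbhs (conj oO Ox).
    apply: filterS => y /nE/(congr1 (fun u : 'rV[R]_3 => u 0 j)) H.
    by move: H => /=; rewrite [X in _ = X]mxE => /esym.
  have hj := has_diff_coord 0 j (has_diffP (has_diff_normal x).1).
  have H := near_has_diff E (has_diffM (has_diffP heps.1) hj).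
  have := H.2 v; rewrite (has_diff_coord 0 j hnQ).2 deps mul0r add0r => ->.
  by rewrite [RHS]mxE.
exists (eps x / c) => v; apply: injQ; rewrite dnQ catenoid_normal_catenoidal.
have hk y : dot (n y) k = dot (nQ y) (vec3 0 0 1) by rewrite -kQ dotQ.
have fk : dot ('D_v f x) k = dot ('D_v cat x) (vec3 0 0 1).
  by rewrite -kQ -(fQ x v Ox) dotQ.
rewrite -scalemxAl mulmxBl -!scalemxAl mulmxBl -scalemxAl kQ (fQ x v Ox) hk fk.
rewrite -/(nQ x) (nE x Ox) dotZl scalerA scalerA; congr (_ *: (_ *: _ - _ *: (_ - _))).
  by rewrite exprMn eps2// mul1r.
by rewrite mulrAC -expr2 eps2// mul1r.
Qed.

End normal_field.
End catenoid_normal.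

(** * From charts to the surface *)

Lemma connected_locally_constant (T : topologicalType) (A : Type) (g : T -> A) :
  connected [set: T] -> (forall p, \forall q \near p, g q = g p) ->
  forall p q, g q = g p.
Proof.
move=> cT lc p q; suff : [set q | g q = g p] = setT.
  by move=> /seteqP[_ /(_ q I)].
apply: cT; first by exists p.
- exists [set q | g q = g p]; last by rewrite setTI.
  rewrite openE => q' /= e; rewrite /interior -e; exact: lc.
- exists [set q | g q = g p]; last by rewrite setTI.
  rewrite -openC openE => q' /= ne; apply: filterS (lc q') => q2 e2 e.
  by apply: ne; rewrite -e2.
Qed.

Lemma C_on_comp_row (R : realType) (V : normedModType R) n q m (D : set V)
    (E : set 'rV[R]_q.+1) (f : V -> 'rV[R]_q.+1)
    (g : 'rV[R]_q.+1 -> 'rV[R]_m.+1) :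
  open D -> open E -> (forall x, D x -> E (f x)) ->
  C_on n D f -> C_on n E g -> C_on n D (fun x => g (f x)).
Proof.
move=> oD oE fE hf hg; apply: C_on_row => // j.
by apply: (C_on_comp (g := fun y => g y 0 j) oD fE hf); exact: C_on_coord.
Qed.

Section catenoidal_charts.
Context (R : realType) (M : surface R) (k : 'rV[R]_3) (F N : M -> 'rV[R]_3).

Lemma compatible_sym (e1 e2 : chart R M) : compatible e1 e2 -> compatible e2 e1.
Proof. by case. Qed.

Lemma transition_expr (e1 e2 : chart R M) (f : M -> 'rV[R]_3) x :
  is_chart e1 -> is_chart e2 -> overlap e1 e2 x ->
  local_expr e2 f (transition e1 e2 x) = local_expr e1 f x.
Proof.
move=> c1 c2 /(overlapP _ _ c1)[_ d2]; rewrite /local_expr /transition.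
by case: c2 => _ _ ->.
Qed.

Lemma catenoidal_at_change (e1 e2 : chart R M) x kap :
  is_chart e1 -> is_chart e2 -> compatible e1 e2 -> overlap e1 e2 x ->
  differentiable (local_expr e2 F) (transition e1 e2 x) ->
  differentiable (local_expr e2 N) (transition e1 e2 x) ->
  catenoidal_at k (local_expr e2 F) (local_expr e2 N) (transition e1 e2 x) kap ->
  catenoidal_at k (local_expr e1 F) (local_expr e1 N) x kap.
Proof.
move=> c1 c2 c12 ox dF dN law v.
rewrite (local_expr_change c1 c2 c12 ox (has_diffP dF)).2.
rewrite (local_expr_change c1 c2 c12 ox (has_diffP dN)).2.
rewrite -(transition_expr N c1 c2 ox); exact: law.
Qed.

Hypotheses (k_unit : dot k k = 1) (F_isom : isometric_immersion F).
Hypothesis N_normal : unit_normal F N.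
Hypothesis theta_range : forall p : M, 0 < angle_fun k N p < pi.

Let law (e : chart R M) x kap :=
  catenoidal_at k (local_expr e F) (local_expr e N) x kap.

Lemma overlap_transition (e1 e2 : chart R M) x : is_chart e1 ->
  overlap e1 e2 x -> chart_cod e2 (transition e1 e2 x).
Proof. by move=> c1 /(overlapP _ _ c1)[_ d2]; exact: chart_cod_map. Qed.

Lemma catenoidal_atlas_change (e1 e2 : chart R M) p kap :
  atlas e1 -> atlas e2 -> chart_dom e1 p -> chart_dom e2 p ->
  law e2 (chart_map e2 p) kap -> law e1 (chart_map e1 p) kap.
Proof.
move=> a1 a2 d1 d2.
have c1 := atlas_chart a1; have c2 := atlas_chart a2.
have ox : overlap e1 e2 (chart_map e1 p) by exists p.
have tE : transition e1 e2 (chart_map e1 p) = chart_map e2 p.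
  by rewrite /transition; case: c1 => _ _ ->.
have cx := chart_cod_map d2.
rewrite -tE in cx *.
exact: (catenoidal_at_change c1 c2 (atlas_compatible a1 a2) ox
  (has_diff_immersion F_isom a2 cx).1 (has_diff_normal N_normal a2 cx).1).
Qed.

Lemma tangent_direction (e : chart R M) x : atlas e -> chart_cod e x ->
  exists u, 'D_u (local_expr e F) x =
    k - dot (local_expr e N x) k *: local_expr e N x.
Proof.
move=> ae cx; exists (tangent_part k F N e x).
exact: etrans (immersionE F_isom ae _ cx) (tangent_partE k_unit F_isom N_normal ae cx).
Qed.

Lemma catenoidal_factor_unique (e : chart R M) x kap1 kap2 :
  atlas e -> chart_cod e x -> law e x kap1 -> law e x kap2 -> kap1 = kap2.
Proof.
move=> ae cx l1 l2; have [u uE] := tangent_direction ae cx.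
have hlt := normal_height_lt1 k_unit N_normal theta_range (chart_inv e x).
have := etrans (esym (catenoidal_height k_unit u l1)) (catenoidal_height k_unit u l2).
rewrite uE dotBl dotZl k_unit -expr2 => eq12.
have s0 : 1 - dot (local_expr e N x) k ^+ 2 != 0 by rewrite gt_eqF.
by apply: oppr_inj; apply: (mulIf s0); apply: (mulIf s0); exact: eq12.
Qed.

(** The factor is unique at each point and does not depend on the chart, so
    it is a function on the surface; it is locally constant and the surface is
    connected. *)
Lemma catenoidal_factor_constant :
  (forall (e : chart R M) x, atlas e -> chart_cod e x -> exists kap, law e x kap) ->
  exists C, forall (e : chart R M) x, atlas e -> chart_cod e x -> law e x C.
Proof.
move=> ex.
pose K p : set R := [set kap | exists2 e : chart R M,
  atlas e /\ chart_dom e p & law e (chart_map e p) kap].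
pose g p : R := xget 0 (K p).
have KP p : K p (g p).
  have [e ae de] := atlas_cover p.
  have [kap hk] := ex e _ ae (chart_cod_map de).
  by apply: (@xgetPex _ 0 (K p)); exists kap; exists e.
have gE (e : chart R M) p kap : atlas e -> chart_dom e p ->
    law e (chart_map e p) kap -> g p = kap.
  move=> ae de l; have [e' [ae' de'] l'] := KP p.
  apply: (catenoidal_factor_unique ae (chart_cod_map de)) l.
  exact: catenoidal_atlas_change l'.
have lc p : \forall q \near p, g q = g p.
  have [e ae de] := atlas_cover p.
  have cx := chart_cod_map de.
  have [kap [r [r0 hr]]] := catenoidal_factor_locally_constant k_unit
    (atlas_cod_open ae) (immersion_smooth F_isom ae) (normal_smooth N_normal ae)
    (fun x v => @immersion_inj _ _ _ F_isom _ ae x v)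
    (fun x => @tangent_direction e x ae)
    (fun x _ => normal_height_lt1 k_unit N_normal theta_range (chart_inv e x)) cx
    (fun x => ex e x ae).
  have [od _ _ cm _] := atlas_chart ae.
  have h1 : nbhs p (chart_dom e) by exact: open_nbhs_nbhs.
  have h2 : nbhs p (chart_map e @^-1` ball (chart_map e p) r).
    by apply: (cm p de); exact: nbhsx_ballx.
  have gp : g p = kap by apply: gE ae de _; exact: (hr _ (ballxx _ r0)).2.
  apply: filterS2 h1 h2 => q dq bq; rewrite gp.
  by apply: gE ae dq _; exact: (hr _ bq).2.
have [[p]|empty] := pselect (exists p : M, True); last first.
  exists 0 => e x ae cx; exfalso; apply: empty.
  by exists (chart_inv e x).
move=> _; exists (g p) => e x ae cx.
have gc := connected_locally_constant (@surface_connected _ M) lc.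
have [dx mx] := chart_codP (atlas_chart ae) cx.
have [kap hk] := ex e x ae cx.
rewrite -(gc p (chart_inv e x)) -{1}mx.
have := gE e (chart_inv e x) kap ae dx; rewrite mx => /(_ hk) ->.
exact: hk.
Qed.

Lemma normal_constant :
  (forall (e : chart R M) x, atlas e -> chart_cod e x -> law e x 0) ->
  forall p q, N q = N p.
Proof.
move=> l0; apply: connected_locally_constant; first exact: surface_connected.
move=> p; have [e ae de] := atlas_cover p.
have cx := chart_cod_map de.
have oD := atlas_cod_open ae.
have /nbhs_ballP[r /= r0 hr] := open_nbhs_nbhs (conj oD cx).
have cst y : ball (chart_map e p) r y ->
    local_expr e N y = local_expr e N (chart_map e p).
  move=> by_; apply/rowP => j; move: y by_.
  apply: (@derive0_ball_constant R _ (fun y => local_expr e N y 0 j)) => y /hr cy.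
  apply: has_diff_eq (has_diff_coord 0 j (has_diff_normal N_normal ae cy)) _ => v.
  by rewrite (l0 e y ae cy v) scale0r mxE.
have [od _ K cm _] := atlas_chart ae.
have h1 : nbhs p (chart_dom e) by exact: open_nbhs_nbhs.
have h2 : nbhs p (chart_map e @^-1` ball (chart_map e p) r).
  by apply: (cm p de); exact: nbhsx_ballx.
apply: filterS2 h1 h2 => q dq /cst; rewrite /local_expr !K//.
Qed.

Section new_chart.
Variables (e0 : chart R M) (W : set 'rV[R]_2) (Phi Psi : 'rV[R]_2 -> 'rV[R]_2).
Hypotheses (ae0 : atlas e0) (oW : open W) (W0 : W `<=` chart_cod e0).
Hypotheses (oPW : open (Phi @` W)) (K : forall x, W x -> Psi (Phi x) = x).
Hypotheses (sPhi : smooth_on W Phi) (sPsi : smooth_on (Phi @` W) Psi).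

(** The chart of coordinates [Phi], where [Psi] is the inverse of [Phi] on [W]. *)
Definition rechart : chart R M :=
  Chart (chart_dom e0 `&` chart_map e0 @^-1` W) (fun p => Phi (chart_map e0 p))
    (fun y => chart_inv e0 (Psi y)).

Lemma rechart_cod : chart_cod rechart = Phi @` W.
Proof.
apply/seteqP; split=> [_ [p [_ Wp] <-]|_ [x Wx <-]]; first by exists (chart_map e0 p).
have [dx mx] := chart_codP (atlas_chart ae0) (W0 Wx).
by exists (chart_inv e0 x); rewrite /= ?mx.
Qed.

Lemma rechart_chart : is_chart rechart.
Proof.
have [od oc K0 cm ci] := atlas_chart ae0; split.
- rewrite openE => p [dp Wp]; apply: filterI; first exact: open_nbhs_nbhs.
  by apply: (cm p dp); exact: open_nbhs_nbhs.
- by rewrite rechart_cod.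
- by move=> p [dp Wp] /=; rewrite K// K0.
- move=> p [dp Wp]; apply: (@continuous_comp _ _ _ (chart_map e0) Phi p (cm p dp)).
  exact: (sPhi 0%N).
- move=> y; rewrite rechart_cod => Py.
  apply: (@continuous_comp _ _ _ Psi (chart_inv e0) y); first exact: (sPsi 0%N).
  by apply: ci; case: Py => x Wx <-; rewrite K//; exact: W0.
Qed.

Lemma rechart_coordinate_chart : coordinate_chart rechart.
Proof.
split; first exact: rechart_chart.
move=> e' ae'; have c' := atlas_chart ae'; have c0 := atlas_chart ae0.
have [s0' s'0] := atlas_compatible ae0 ae'.
split=> i.
- apply: (@C_on_comp_row _ _ _ _ _ _ (overlap e0 e') Psi (transition e0 e')).
  + exact: overlap_open rechart_chart c'.
  + exact: overlap_open.
  + move=> _ [p [[dp Wp] dp'] <-] /=; rewrite K//; by exists p.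
  + apply: C_on_sub (sPsi i) => _ [p [[dp Wp] dp'] <-] /=.
    by exists (chart_map e0 p).
  + exact: s0'.
- apply: (@C_on_comp_row _ _ _ _ _ _ W (transition e' e0) Phi) => //.
  + exact: overlap_open c' rechart_chart.
  + by move=> x /(overlapP _ _ c')[_ []].
  + apply: C_on_sub (s'0 i) => x /(overlapP _ _ c')[cx [dx _]].
    by apply/overlapP.
Qed.

End new_chart.

(** A zero factor would make the normal, hence the angle function, constant.
    Otherwise [catenoid_coordinates] applies around any point. *)
Lemma catenoidal_locally_catenoid :
  (~ exists t : R, forall p : M, angle_fun k N p = t) ->
  (forall (e : chart R M) x, atlas e -> chart_cod e x -> exists kap, law e x kap) ->
  locally_catenoid k F.
Proof.
move=> nonconst ex p.
have [C lawC] := catenoidal_factor_constant ex.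
have C0 : C != 0.
  apply/eqP => C0; apply: nonconst; exists (angle_fun k N p) => q.
  by rewrite /angle_fun (normal_constant _ p q)// => e x ae cx; rewrite -C0; exact: lawC.
have [e0 ae0 de0] := atlas_cover p.
have cx0 := chart_cod_map de0; have oD := atlas_cod_open ae0.
have /nbhs_ballP[r /= r0 hr] := open_nbhs_nbhs (conj oD cx0).
have [_ n1 _] := N_normal.
have [c [G [W [Phi [Psi [[c0 iG kG] [oW Wx0 WD oPW] [sPhi sPsi] K GF]]]]]] :=
  catenoid_coordinates k_unit oD (immersion_smooth F_isom ae0)
    (normal_smooth N_normal ae0)
    (fun x v => @immersion_inj _ _ _ F_isom _ ae0 x v)
    (fun x => n1 (chart_inv e0 x))
    (fun x _ => normal_height_lt1 k_unit N_normal theta_range (chart_inv e0 x))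
    C0 r0 hr (fun y by_ => lawC e0 y ae0 (hr y by_)).
exists c, G, (rechart e0 W Phi Psi); split=> //.
  by split; [exact: rechart_coordinate_chart|split].
move=> x y; rewrite rechart_cod// => -[z Wz zxy].
rewrite /= -zxy K// (GF z Wz) zxy.
by have [-> ->] := vec2E x y.
Qed.

(** The computation is made in the chart where the immersion is a catenoid;
    as that chart need not belong to the atlas, smoothness and orthogonality
    are first transported to it, and the conclusion is transported back. *)
Lemma locally_catenoid_catenoidal : locally_catenoid k F ->
  forall (e : chart R M) x, atlas e -> chart_cod e x -> exists kap, law e x kap.
Proof.
move=> lc e1 x1 ae1 cx1.
have [c [G [e [c0 iG kG [[ce comp] de] GF]]]] := lc (chart_inv e1 x1).
have c1 := atlas_chart ae1; have ce1 := comp _ ae1.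
have [dx1 mx1] := chart_codP c1 cx1.
pose x := transition e1 e x1.
have ox1 : overlap e1 e x1 by apply/overlapP.
have cxe : chart_cod e x := overlap_transition c1 ox1.
have ix : chart_inv e x = chart_inv e1 x1.
  by rewrite /x /transition; case: ce => _ _ ->.
have ox : overlap e e1 x by apply/overlapP; rewrite ?ix.
have oO := overlap_open ce c1.
have hF y : overlap e e1 y -> has_diff (local_expr e F) y
    (fun v => 'D_('D_v (transition e e1) y) (local_expr e1 F) (transition e e1 y)).
  move=> oy; have h := has_diff_immersion F_isom ae1 (overlap_transition ce oy).
  exact: (local_expr_change ce c1 ce1 oy h).
have hN y : overlap e e1 y -> has_diff (local_expr e N) y
    (fun v => 'D_('D_v (transition e e1) y) (local_expr e1 N) (transition e e1 y)).
  move=> oy; have h := has_diff_normal N_normal ae1 (overlap_transition ce oy).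
  exact: (local_expr_change ce c1 ce1 oy h).
have [_ n1 _] := N_normal.
have [kap hk] : exists kap, law e x kap.
  apply: (catenoid_catenoidal_at c0 iG kG oO ox) => //.
  - by move=> y /(overlapP _ _ ce)[cy _]; rewrite -GF vec2_eta.
  - by move=> y; exact: n1.
  - move=> y v oy; rewrite (hF y oy).2 -(transition_expr N ce c1 oy).
    exact: (normal_ortho F_isom N_normal ae1 _ (overlap_transition ce oy)).
  - exact: (hN x ox).1.
  - by move=> y /hF[].
exists kap.
exact: (catenoidal_at_change c1 ce (compatible_sym ce1) ox1 (hF x ox).1 (hN x ox).1).
Qed.

End catenoidal_charts.

Theorem theorem3 (R : realType) (M : surface R) (k : 'rV[R]_3)
    (F N : M -> 'rV[R]_3)
    (k_unit : dot k k = 1)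
    (F_isom : isometric_immersion F)
    (N_normal : unit_normal F N)
    (theta_range : forall p : M,
       0 < angle_fun k N p < pi /\ angle_fun k N p != pi / 2)
    (theta_nonconst : ~ exists t : R, forall p : M, angle_fun k N p = t) :
  (minimal F N /\ U_principal k F N) <-> locally_catenoid k F.
Proof.
have range p := (theta_range p).1.
split=> [[Nmin Uprin]|lc].
  apply: (catenoidal_locally_catenoid k_unit F_isom N_normal range theta_nonconst).
  move=> e x ae cx; apply/(catenoidal_atP k_unit F_isom N_normal range ae cx).
  by split; [exact: Nmin|exact: Uprin].
have ex := locally_catenoid_catenoidal F_isom N_normal lc.
by split=> e x ae cx;
  have [] := (catenoidal_atP k_unit F_isom N_normal range ae cx).2 (ex e x ae cx).
Qed.
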